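(* Let $L\ge1$, $\mathcal L=\llbracket 1,L\rrbracket$, and consider a discrete memoryless multiple access channel $(\mathcal X_{\mathcal L},q_{Z|X_{\mathcal L}},\mathcal Z)$ with $\mathcal X_l=\{0,1\}$ for all $l\in\mathcal L$, $\mathcal Z$ finite, and $X_{\mathcal L}=(X_l)_{l\in\mathcal L}$. Let $q_Z$ be a target distribution of the form $q_Z(z)=\sum_{x_{\mathcal L}}q_{Z|X_{\mathcal L}}(z|x_{\mathcal L})\prod_{l}q_{X_l}(x_l)$. Then the multiple access channel resolvability region satisfies $\mathcal R_{q_Z}=\mathcal R'_{q_Z}$, where $$\mathcal R'_{q_Z}\triangleq\bigcup_{p_T,(q_{X_l|T})_{l\in\mathcal L}}\{(R_l)_{l\in\mathcal L}: I(X_{\mathcal S};Z|T)\le R_{\mathcal S}\ \ \forall\mathcal S\subseteq\mathcal L\},$$ the union being over distributions $p_T$ on $\mathcal T=\llbracket 1,|\mathcal Z|+2^L-1\rrbracket$ and conditional distributions $(q_{X_l|T})_{l\in\mathcal L}$ such that for every $t\in\mathcal T$ and $z\in\mathcal Z$, $q_Z(z)=\sum_{x_{\mathcal L}}q_{Z|X_{\mathcal L}}(z|x_{\mathcal L})\prod_{l\in\mathcal L}q_{X_l|T}(x_l|t)$.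
   Context: $R_{\mathcal S}=\sum_{l\in\mathcal S}R_l$ and $X_{\mathcal S}=(X_l)_{l\in\mathcal S}$; information quantities are computed under $p_T(t)\prod_lq_{X_l|T}(x_l|t)q_{Z|X_{\mathcal L}}(z|x_{\mathcal L})$. A code with rates $(R_l)_{l\in\mathcal L}$ and blocklength $N$ consists of independent uniform randomization sequences $S_l\in\llbracket 1,2^{NR_l}\rrbracket$ and encoders $f_{l,N}:\llbracket1,2^{NR_l}\rrbracket\to\mathcal X_l^N$; Transmitter $l$ sends $f_{l,N}(S_l)$, inducing an output distribution $\widetilde p_{Z^{1:N}}$. A rate tuple is achievable if there is a sequence of such codes with $\lim_{N\to\infty}\mathbb V(\widetilde p_{Z^{1:N}},\prod_{i=1}^Nq_Z)=0$, where $\mathbb V(p,q)=\sum_x|p(x)-q(x)|$; $\mathcal R_{q_Z}$ is the closure of the set of achievable rate tuples. *)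

(* Defs.v *)
From HB Require Import structures.
From mathcomp Require Import all_boot all_order all_algebra.
From mathcomp Require Import all_classical all_reals all_analysis.
Set Implicit Arguments. Unset Strict Implicit. Unset Printing Implicit Defensive.
Import Order.TTheory GRing.Theory Num.Theory.
Import numFieldNormedType.Exports.
Local Open Scope classical_set_scope.
Local Open Scope ring_scope.

Section MACRes.
Variables (R : realType) (L : nat) (Z : finType).

Definition inp := {ffun 'I_L -> bool}.

Definition log2 (x : R) : R := ln x / ln 2.

Definition is_channel (W : inp -> Z -> R) : Prop :=
  (forall x z, 0 <= W x z) /\ (forall x, \sum_z W x z = 1).

Definition is_pmf (A : finType) (p : A -> R) : Prop :=
  (forall a, 0 <= p a) /\ \sum_a p a = 1.

Definition out_dist (W : inp -> Z -> R) (q : 'I_L -> bool -> R) (z : Z) : R :=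
  \sum_(x : inp) W x z * \prod_(l < L) q l (x l).

Definition cmi (T A B : finType) (p : T -> A -> B -> R) : R :=
  \sum_t \sum_a \sum_b
    p t a b * log2 (p t a b * (\sum_a' \sum_b' p t a' b')
                   / ((\sum_b' p t a b') * (\sum_a' p t a' b))).

(* X_S represented as the restriction of x_L to S (coordinates outside S set to false) *)
Definition restr (S : {set 'I_L}) (x : inp) : inp :=
  [ffun l => if l \in S then x l else false].

Definition joint_TXSZ (T : finType) (W : inp -> Z -> R) (pT : T -> R)
  (qXT : 'I_L -> T -> bool -> R) (S : {set 'I_L}) (t : T) (a : inp) (z : Z) : R :=
  \sum_(x : inp | restr S x == a) pT t * (\prod_(l < L) qXT l t (x l)) * W x z.

Definition MI_XS_Z_T (T : finType) (W : inp -> Z -> R) (pT : T -> R)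
  (qXT : 'I_L -> T -> bool -> R) (S : {set 'I_L}) : R :=
  cmi (joint_TXSZ W pT qXT S).

Definition msize (r : 'I_L -> R) (N : nat) (l : 'I_L) : nat :=
  Num.truncn (powR 2 (N%:R * r l)).

Definition code_out (W : inp -> Z -> R) (N : nat) (M : 'I_L -> nat)
  (f : forall l : 'I_L, 'I_(M l) -> {ffun 'I_N -> bool}) (z : {ffun 'I_N -> Z}) : R :=
  (\prod_(l < L) (M l)%:R)^-1 *
  \sum_(s : {dffun forall l : 'I_L, 'I_(M l)})
     \prod_(i < N) W [ffun l => f l (s l) i] (z i).

Definition tvd (A : finType) (p q : A -> R) : R := \sum_a `|p a - q a|.

Definition achievable (W : inp -> Z -> R) (qZ : Z -> R) (r : 'I_L -> R) : Prop :=
  exists f : forall (N : nat) (l : 'I_L), 'I_(msize r N l) -> {ffun 'I_N -> bool},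
    (fun N : nat => tvd (code_out W (f N))
                        (fun z : {ffun 'I_N -> Z} => \prod_(i < N) qZ (z i)))
      @ \oo --> (0 : R).

(* closure in R^L (sup-distance, equivalently product topology) *)
Definition in_closure (A : ('I_L -> R) -> Prop) (r : 'I_L -> R) : Prop :=
  forall e : R, 0 < e -> exists r', A r' /\ forall l, `|r l - r' l| < e.

Definition res_region (W : inp -> Z -> R) (qZ : Z -> R) (r : 'I_L -> R) : Prop :=
  in_closure (achievable W qZ) r.

Definition Tcard : nat := #|Z| + 2 ^ L - 1.

Definition region' (W : inp -> Z -> R) (qZ : Z -> R) (r : 'I_L -> R) : Prop :=
  exists (pT : 'I_Tcard -> R) (qXT : 'I_L -> 'I_Tcard -> bool -> R),
    is_pmf pT /\
    (forall l t, is_pmf (qXT l t)) /\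
    (forall t z, qZ z = out_dist W (fun l => qXT l t) z) /\
    (forall S : {set 'I_L}, MI_XS_Z_T W pT qXT S <= \sum_(l in S) r l).

End MACRes.

(* Main.v *)
(** Write [W_S] for the channel seen by the users in [S] once the other users
    draw their inputs independently from the product law.

    Achievability is soft covering by random codebooks.  All that is used about
    the empirical law [pi] of a random codebook of size [M] is
    [E pi(x) pi(x') <= p(x) (1[x = x'] / M + p(x'))].  Multiplying this bound over
    the users and expanding the product over subsets [S], Jensen's inequality
    gives that the expected divergence between output and target is at most
    [E ln (sum_S W_S / (M_S q))], which is
    [<= 1/r sum_(S <> 0) E (W_S / (M_S q))^r] for [0 < r <= 1].  These moments
    factorize over the letters, and their exponent is governed by [I(X_S;Z|T)] as
    [r] tends to 0.  The time-sharing sequence is averaged over as well, which is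
    harmless since every value of [T] produces exactly [q_Z].

    For the converse, an input law supported on [M] atoms of mass at least [1/M]
    satisfies [W_S <= M_S P] for the output law [P] of the code, so
    [ln M_S >= E ln W_S - E ln P]; Gibbs' inequality single-letterizes the first
    term and the closeness of [P] to [q_Z^N] turns the second into a sum of
    [- E ln q_Z].  Every letter has output law close to [q_Z].  Caratheodory's
    theorem bounds the number of time-sharing values by [2^L], and compactness of
    the space of parameters removes the approximations. *)
Require Import Defs.
From HB Require Import structures.
From mathcomp Require Import all_boot all_order all_algebra.
From mathcomp Require Import all_classical all_reals all_analysis.
From mathcomp Require Import ring lra.
Import Order.TTheory GRing.Theory Num.Theory numFieldNormedType.Exports.
Local Open Scope ring_scope.
Set Implicit Arguments. Unset Strict Implicit. Unset Printing Implicit Defensive.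

(** * Product laws and their conditionals *)

Section ProductSums.
Variable R : comNzRingType.

(** Distributivity in dependent form, since the message and codebook types vary with the user. The
    families of tagged values behind [big_fprod] reduce it to the non-dependent law. *)
Lemma sum_dffun_prod (I : finType) (T : I -> finType)
    (F : forall i, T i -> R) :
  \sum_(s : {dffun forall i, T i}) \prod_i F i (s i) =
  \prod_i \sum_(m : T i) F i m.
Proof.
have -> : \prod_i \sum_(m : T i) F i m =
    \prod_i \sum_(j in tagged_with T i) untag 0 (F i) j.
  by apply: eq_bigr => i _; rewrite big_tag.
rewrite bigA_distr_big_dep.
have := @big_fprod R 0 1 *%R +%R I T (fun i => [ffun m => F i m]).
have -> : \sum_(g in family (tagged_with T))
            \prod_i untag 0 [ffun m => F i m] (g i) =
          \sum_(g in family (tagged_with T)) \prod_i untag 0 (F i) (g i).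
  apply: eq_bigr => g _; apply: eq_bigr => i _.
  by rewrite /untag; case: eqP => // e; rewrite ffunE.
move=> <-.
rewrite (reindex (@dffun_of_fprod I T)); last exact/onW_bij/dffun_of_fprod_bij.
apply: eq_bigr => s _; apply: eq_bigr => i _.
by rewrite !ffunE.
Qed.

Lemma sum_ffun_prod (I J : finType) (F : I -> J -> R) :
  \sum_(f : {ffun I -> J}) \prod_i F i (f i) = \prod_i \sum_j F i j.
Proof. by rewrite bigA_distr_bigA. Qed.

Lemma marginal_ffun (I J : finType) (F : I -> J -> R) (k : I) (g : J -> R) :
  (forall i, \sum_j F i j = 1) ->
  \sum_(y : {ffun I -> J}) (\prod_i F i (y i)) * g (y k) = \sum_j F k j * g j.
Proof.
move=> F1.
transitivity (\sum_(y : {ffun I -> J})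
    \prod_i (F i (y i) * (if i == k then g (y i) else 1))).
  apply: eq_bigr => y _; rewrite big_split /=; congr (_ * _).
  by rewrite (bigD1 k) //= eqxx big1 ?mulr1 // => i /negbTE ->.
rewrite (sum_ffun_prod (fun i j => F i j * (if i == k then g j else 1))).
rewrite (bigD1 k) //= eqxx [X in _ * X]big1 ?mulr1 // => i /negbTE ->.
by under eq_bigr do rewrite mulr1; apply: F1.
Qed.

Lemma prod_delta (I J : finType) (x y : {ffun I -> J}) :
  \prod_i (x i == y i)%:R = (x == y)%:R :> R.
Proof.
case: (eqVneq x y) => [->|/eqP xy]; first by rewrite big1 // => i _; rewrite eqxx.
have [i xyi] : exists i, x i != y i.
  apply/existsP; rewrite -negb_forall; apply/negP => /forallP h.
  by apply: xy; apply/ffunP => i; apply/eqP.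
by rewrite (bigD1 i) //= (negbTE xyi) mul0r.
Qed.

(** Images of independent variables are independent: the indicator that the whole image vector
    equals [x] is a product of coordinate indicators, so the image law factorizes. *)
Lemma pushforward_dffun (I : finType) (T : I -> finType) (J : finType)
    (P : forall i, T i -> R) (h : forall i, T i -> J) (g : {ffun I -> J} -> R) :
  \sum_(s : {dffun forall i, T i})
     (\prod_i P i (s i)) * g [ffun i => h i (s i)] =
  \sum_(x : {ffun I -> J})
     (\prod_i \sum_(m : T i) P i m * (h i m == x i)%:R) * g x.
Proof.
under [RHS]eq_bigr => x _ do rewrite -sum_dffun_prod mulr_suml.
rewrite exchange_big /=; apply: eq_bigr => s _.
rewrite (bigD1 [ffun i => h i (s i)]) //= [X in _ + X]big1 ?addr0 => [|x hx].
  congr (_ * _); apply: eq_bigr => i _; by rewrite ffunE eqxx mulr1.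
rewrite big_split /=.
have -> : \prod_i (h i (s i) == x i)%:R = ([ffun i => h i (s i)] == x)%:R :> R.
  by rewrite -prod_delta; apply: eq_bigr => i _; rewrite ffunE.
by rewrite eq_sym (negbTE hx) mulr0 mul0r.
Qed.

Lemma pushforward_ffun (I K J : finType) (P : I -> K -> R) (h : K -> J)
    (g : {ffun I -> J} -> R) :
  \sum_(s : {ffun I -> K}) (\prod_i P i (s i)) * g [ffun i => h (s i)] =
  \sum_(x : {ffun I -> J})
     (\prod_i \sum_m P i m * (h m == x i)%:R) * g x.
Proof.
under [RHS]eq_bigr => x _ do rewrite bigA_distr_bigA mulr_suml.
rewrite exchange_big /=; apply: eq_bigr => s _.
rewrite (bigD1 [ffun i => h (s i)]) //= [X in _ + X]big1 ?addr0 => [|x hx].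
  congr (_ * _); apply: eq_bigr => i _; by rewrite ffunE eqxx mulr1.
rewrite big_split /=.
have -> : \prod_i (h (s i) == x i)%:R = ([ffun i => h (s i)] == x)%:R :> R.
  by rewrite -prod_delta; apply: eq_bigr => i _; rewrite ffunE.
by rewrite eq_sym (negbTE hx) mulr0 mul0r.
Qed.

End ProductSums.

Definition slice (I K B : finType) (x : {ffun I -> {ffun K -> B}}) (k : K) :
  {ffun I -> B} := [ffun l => x l k].

Lemma sum_slice_prod (R : comNzRingType) (I K B : finType)
    (F : K -> {ffun I -> B} -> R) :
  \sum_(x : {ffun I -> {ffun K -> B}}) \prod_k F k (slice x k) =
  \prod_k \sum_a F k a.
Proof.
rewrite bigA_distr_bigA.
pose tr (I K : finType) (x : {ffun I -> {ffun K -> B}}) : {ffun K -> {ffun I -> B}} :=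
  [ffun k => [ffun l => x l k]].
have trK (I' K' : finType) : cancel (@tr I' K') (@tr K' I').
  by move=> x; apply/ffunP => l; apply/ffunP => k; rewrite !ffunE.
rewrite (reindex (@tr K I)); last by apply/onW_bij; exists (@tr I K); exact: trK.
apply: eq_bigr => f _; apply: eq_bigr => k _; congr (F k _).
by apply/ffunP => l; rewrite !ffunE.
Qed.

Section Pmf.
Variable R : realType.

Lemma pmf_le1 (A : finType) (p : A -> R) a : is_pmf p -> p a <= 1.
Proof.
move=> [p0 <-]; rewrite (bigD1 a) //= lerDl; apply: sumr_ge0 => *; exact: p0.
Qed.

(** The first-moment principle behind every random selection below. If [F] exceeded [c] everywhere,
    the nonnegative terms [p a * (F a - c)] would have sum at most 0, forcing [p] to vanish. *)
Lemma avg_exists (A : finType) (p F : A -> R) (c : R) :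
  is_pmf p -> \sum_a p a * F a <= c -> exists a, F a <= c.
Proof.
move=> [p0 p1] h; apply: contrapT => /forallNP hn.
have hlt a : c < F a by rewrite ltNge; apply/negP/hn.
have : \sum_a p a * (F a - c) <= 0.
  under eq_bigr do rewrite mulrBr.
  by rewrite sumrB -mulr_suml p1 mul1r subr_le0.
move=> hle.
have h0 : \sum_a p a * (F a - c) = 0.
  apply/eqP; rewrite eq_le hle /=; apply: sumr_ge0 => a _.
  by rewrite mulr_ge0 // subr_ge0 ltW.
move/eqP: h0; rewrite psumr_eq0; last first.
  by move=> a _; rewrite mulr_ge0 // subr_ge0 ltW.
move/allP => h0.
have : \sum_a p a = 0.
  rewrite big1 // => a _; have := h0 a (mem_index_enum a).
  by rewrite /= mulf_eq0 subr_eq0 (gt_eqF (hlt a)) orbF => /eqP.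
by rewrite p1 => /eqP; rewrite oner_eq0.
Qed.

End Pmf.

Section Kernel.
Variables (R : realType) (L : nat) (X : finType).
Implicit Types (p : 'I_L -> X -> R) (S : {set 'I_L}) (x : {ffun 'I_L -> X}).

Definition pprod p x : R := \prod_l p l (x l).

(* Conditional law of [x'] under [pprod p], given that it agrees with [x] on [S]. *)
Definition ker p S x x' : R :=
  \prod_l (if l \in S then (x' l == x l)%:R else p l (x' l)).

Definition cond p S (V : {ffun 'I_L -> X} -> R) x : R :=
  \sum_x' ker p S x x' * V x'.

Lemma pprod_pmf p : (forall l, is_pmf (p l)) -> is_pmf (pprod p).
Proof.
move=> hp; split=> [x|]; first by apply: prodr_ge0 => l _; apply: (hp l).1.
by rewrite sum_ffun_prod big1 // => l _; apply: (hp l).2.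
Qed.

Lemma ker_ge0 p S x x' : (forall l, is_pmf (p l)) -> 0 <= ker p S x x'.
Proof.
by move=> hp; apply: prodr_ge0 => l _; case: ifP => _; [exact: ler0n|apply: (hp l).1].
Qed.

Lemma ker_sum p S x : (forall l, is_pmf (p l)) -> \sum_x' ker p S x x' = 1.
Proof.
move=> hp.
rewrite (sum_ffun_prod (fun l b => if l \in S then (b == x l)%:R else p l b)).
rewrite big1 // => l _; case: (l \in S); last exact: (hp l).2.
by rewrite (bigD1 (x l)) //= eqxx big1 ?addr0 // => b /negbTE ->.
Qed.

Lemma ker_agree p S x x' l : l \in S -> ker p S x x' != 0 -> x' l = x l.
Proof.
move=> lS; rewrite /ker (bigD1 l) //= lS.
by have [//|_] := eqVneq (x' l) (x l); rewrite mulr0n mul0r eqxx.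
Qed.

(** Detailed balance: each side is the law of a pair of input vectors sharing their coordinates in
    [S] and independent elsewhere, which is symmetric. *)
Lemma ker_rev p S x x' : pprod p x * ker p S x x' = pprod p x' * ker p S x' x.
Proof.
rewrite /pprod /ker -!big_split /=; apply: eq_bigr => l _.
case: ifP => _; last by rewrite mulrC.
by rewrite eq_sym; case: eqP => [->//|_]; rewrite mulr0n !mulr0.
Qed.

(** Conditional expectation given [X_S]: reversibility moves the kernel from [V] to [g], and [g] is
    constant along the kernel. *)
Lemma cond_tower p S (V g : {ffun 'I_L -> X} -> R) :
  (forall l, is_pmf (p l)) ->
  (forall x x', (forall l, l \in S -> x' l = x l) -> g x' = g x) ->
  \sum_x pprod p x * cond p S V x * g x = \sum_x pprod p x * V x * g x.
Proof.
move=> hp hg.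
transitivity (\sum_x \sum_x' pprod p x' * ker p S x' x * V x' * g x').
  apply: eq_bigr => x _; rewrite /cond mulr_sumr mulr_suml; apply: eq_bigr => x' _.
  rewrite mulrA ker_rev -!mulrA.
  have [->|k0] := eqVneq (ker p S x' x) 0; first by rewrite !mul0r.
  by rewrite (hg x' x) // => l lS; rewrite (ker_agree lS k0).
rewrite exchange_big /=; apply: eq_bigr => x _.
under eq_bigr do rewrite -!mulrA mulrCA.
by rewrite -mulr_suml ker_sum // mul1r mulrA.
Qed.

Lemma cond_ge0 p S (V : {ffun 'I_L -> X} -> R) x :
  (forall l, is_pmf (p l)) -> (forall x, 0 <= V x) -> 0 <= cond p S V x.
Proof.
by move=> hp hV; apply: sumr_ge0 => x' _; rewrite mulr_ge0 // ker_ge0.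
Qed.

Lemma cond_agree p S (V : {ffun 'I_L -> X} -> R) x x' :
  (forall l, l \in S -> x' l = x l) -> cond p S V x' = cond p S V x.
Proof.
move=> h; apply: eq_bigr => y _; congr (_ * _); apply: eq_bigr => l _.
by case: ifP => // lS; rewrite h.
Qed.

Lemma cond_sum (Y : finType) p S (V : {ffun 'I_L -> X} -> Y -> R) x :
  (forall l, is_pmf (p l)) -> (forall x, \sum_y V x y = 1) ->
  \sum_y cond p S (V ^~ y) x = 1.
Proof.
move=> hp hV; rewrite /cond exchange_big /=.
under eq_bigr do rewrite -mulr_sumr hV mulr1.
exact: ker_sum.
Qed.

Lemma cond_gt0 p S (V : {ffun 'I_L -> X} -> R) x :
  (forall l, is_pmf (p l)) -> (forall x, 0 <= V x) ->
  0 < pprod p x * V x -> 0 < cond p S V x.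
Proof.
move=> hp hV; have [px0 _] := pprod_pmf hp.
rewrite lt_def => /andP[pV0 _]; have pV : 0 < pprod p x * V x.
  by rewrite lt_def pV0 mulr_ge0.
have Vx : 0 < V x by rewrite lt_def hV andbT; apply: contra pV0 => /eqP ->; rewrite mulr0.
have px : pprod p x != 0 by apply: contra pV0 => /eqP ->; rewrite mul0r.
rewrite /cond (bigD1 x) //= ltr_pwDl //; last first.
  by apply: sumr_ge0 => x' _; rewrite mulr_ge0 // ker_ge0.
rewrite mulr_gt0 // prodr_gt0 // => l _; case: ifP => _; first by rewrite eqxx ltr01.
rewrite lt_def (hp l).1 andbT; apply: contra px => /eqP pl.
by rewrite /pprod (bigD1 l) //= pl mul0r.
Qed.

Lemma cond_set0 p (V : {ffun 'I_L -> X} -> R) x :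
  cond p finset.set0 V x = \sum_x' pprod p x' * V x'.
Proof.
apply: eq_bigr => x' _; congr (_ * _); apply: eq_bigr => l _; by rewrite inE.
Qed.

End Kernel.

(** * Random codebooks *)

Section LogInequalities.
Variable R : realType.
Implicit Types a b x y : R.

Lemma ln_le_subr1 x : 0 < x -> ln x <= x - 1.
Proof.
move=> x0; have := @le_ln1Dx R (x - 1); rewrite (_ : 1 + (x - 1) = x); last by ring.
by apply; lra.
Qed.

Lemma ln_le_tangent x y : 0 < x -> 0 < y -> ln x <= ln y + x / y - 1.
Proof.
move=> x0 y0; have := ln_le_subr1 (divr_gt0 x0 y0).
by rewrite ln_div ?posrE // => h; lra.
Qed.

Lemma le_powR_id a r : 0 <= a -> a <= 1 -> 0 < r -> r <= 1 -> a <= a `^ r.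
Proof.
rewrite le_eqVlt => /orP[/eqP <- _ r0 _|a0 a1 r0 r1]; first exact: powR_ge0.
by rewrite ger1_powR ?a0 ?a1 //.
Qed.

(** For [a <= 1] use [ln (1 + a) <= a <= a^r]. For [a > 1] use [ln (1 + a) <= ln a + 1] and
    [r ln a <= a^r - 1]; the leftover [1 - 1/r] is nonpositive. *)
Lemma ln1D_le_powR a r : 0 <= a -> 0 < r -> r <= 1 -> ln (1 + a) <= r^-1 * a `^ r.
Proof.
move=> a0 r0 r1.
have ri : 1 <= r^-1 by rewrite invf_ge1.
have [a1|a1] := leP a 1.
  apply: (@le_trans _ _ a); first by apply: le_ln1Dx; lra.
  apply: (le_trans (le_powR_id a0 a1 r0 r1)).
  by rewrite ler_peMl // powR_ge0.
have a0' : 0 < a by lra.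
have h1 : ln (1 + a) <= ln a + 1.
  have := @ln_le_tangent (1 + a) a ltac:(lra) a0'.
  rewrite mulrDl divff ?gt_eqF // mul1r => h.
  have : a^-1 <= 1 by rewrite invf_le1 // ltW.
  lra.
have h2 : r * ln a <= a `^ r - 1.
  by rewrite -ln_powR; apply: ln_le_subr1; exact: powR_gt0.
have h3 : ln a <= r^-1 * (a `^ r - 1) by rewrite ler_pdivlMl.
nra.
Qed.

(** Iterates [1 + a + s <= (1 + a)(1 + s)]; nonnegativity of the partial sum [s] is carried through
    the induction. *)
Lemma ln1D_sum (I : finType) (P : pred I) (a : I -> R) :
  (forall i, P i -> 0 <= a i) ->
  ln (1 + \sum_(i | P i) a i) <= \sum_(i | P i) ln (1 + a i).
Proof.
move=> a0.
have [] // : 0 <= \sum_(i | P i) a i /\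
  ln (1 + \sum_(i | P i) a i) <= \sum_(i | P i) ln (1 + a i).
apply: (big_rec2 (fun s t => 0 <= s /\ ln (1 + s) <= t)).
  by rewrite addr0 ln1.
move=> i s t Pi [s0 hs]; split; first by rewrite addr_ge0 ?a0.
have ai := a0 i Pi.
apply: (@le_trans _ _ (ln ((1 + a i) * (1 + s)))); last first.
  by rewrite lnM ?posrE ?lerD2l //; lra.
rewrite ler_ln ?posrE; nra.
Qed.

(* [(sqrt p - sqrt q)^2 <= p ln (p/q) - p + q], combined with AM-GM. *)
Lemma abs_sub_le_divergence (l p q : R) : 0 < l -> 0 <= p -> 0 <= q -> (q = 0 -> p = 0) ->
  `|p - q| <= (2 * l)^-1 * (p * ln (p / q) - p + q) + l * (p + q).
Proof.
move=> l0 p0 q0 qp.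
have [q00|qn0] := eqVneq q 0.
  rewrite (qp q00) q00 !mul0r; rewrite subrr normr0; lra.
have qgt : 0 < q by rewrite lt_def qn0.
set s := Num.sqrt p; set t := Num.sqrt q.
have s0 : 0 <= s := sqrtr_ge0 p.
have t0 : 0 < t by rewrite sqrtr_gt0.
have ps : p = s ^+ 2 by rewrite sqr_sqrtr.
have qt : q = t ^+ 2 by rewrite sqr_sqrtr.
clearbody s t.
have hd : (s - t) ^+ 2 <= p * ln (p / q) - p + q.
  have [s00|sn0] := eqVneq s 0.
    by rewrite ps qt s00 expr0n /= mul0r; lra.
  have sgt : 0 < s by rewrite lt_def sn0.
  have -> : ln (p / q) = - (2 * ln (t / s)).
    have e : ln (s / t) = - ln (t / s) by rewrite -lnV ?posrE ?divr_gt0 // invf_div.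
    by rewrite ps qt -expr_div_n lnXn ?divr_gt0 // e; ring.
  have h := ln_le_subr1 (divr_gt0 t0 sgt).
  have h2 : p * (t / s) = s * t by rewrite ps; field.
  have h3 : p * ln (t / s) <= s * t - p by rewrite -h2; nra.
  have -> : (s - t) ^+ 2 = p - 2 * (s * t) + q by rewrite ps qt; ring.
  rewrite mulrN mulrCA; lra.
have hpq : `|p - q| = `|s - t| * (s + t).
  by rewrite ps qt subr_sqr normrM (ger0_norm (addr_ge0 s0 (ltW t0))).
have hsum : (s + t) ^+ 2 <= 2 * (p + q) by have := sqr_ge0 (s - t); rewrite ps qt; lra.
have hsq : (s - t) ^+ 2 = `|s - t| ^+ 2 by rewrite real_normK ?num_real.
rewrite hpq; set u := `|s - t| in hsq *; set v := s + t in hsum *.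
set d := p * _ - p + q in hd *.
have ineq : u * v <= (2 * l)^-1 * u ^+ 2 + l / 2 * v ^+ 2.
  rewrite -subr_ge0.
  have -> : (2 * l)^-1 * u ^+ 2 + l / 2 * v ^+ 2 - u * v =
            (2 * l)^-1 * (u - l * v) ^+ 2 by field; lra.
  by rewrite mulr_ge0 ?sqr_ge0 // invr_ge0; lra.
apply: (le_trans ineq); apply: lerD.
  by rewrite ler_pM2l ?invr_gt0 -?hsq //; lra.
nra.
Qed.

End LogInequalities.

(** * First two moments of the empirical law of a random codebook *)

Section RandomCodebook.
Variables (R : realType) (X : finType) (M : nat) (p : X -> R).
Hypothesis hp : is_pmf p.

Definition empirical (c : {ffun 'I_M -> X}) (b : X) : R :=
  \sum_m M%:R^-1 * (c m == b)%:R.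

Definition iid (c : {ffun 'I_M -> X}) : R := \prod_m p (c m).

Lemma iid_ge0 c : 0 <= iid c.
Proof. by apply: prodr_ge0 => m _; apply: hp.1. Qed.

Lemma empirical_ge0 c b : 0 <= empirical c b.
Proof. by apply: sumr_ge0 => m _; rewrite mulr_ge0. Qed.

Lemma empirical_sum c : (0 < M)%N -> \sum_b empirical c b = 1.
Proof.
move=> M0; rewrite /empirical exchange_big /=.
under eq_bigr => m _.
  rewrite -mulr_sumr (bigD1 (c m)) //= eqxx big1 ?addr0 ?mulr1 => [|b]; last first.
    by rewrite eq_sym => /negbTE ->.
  over.
by rewrite sumr_const card_ord -[LHS]mulr_natl divff // pnatr_eq0 -lt0n.
Qed.

Lemma iid_mean1 (m : 'I_M) (g : X -> R) :
  \sum_c iid c * g (c m) = \sum_b p b * g b.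
Proof.
by rewrite (marginal_ffun (F := fun=> p) m g) // => i; exact: hp.2.
Qed.

Lemma iid_mean2 (m m' : 'I_M) (g h : X -> R) : m != m' ->
  \sum_c iid c * (g (c m) * h (c m')) = (\sum_b p b * g b) * (\sum_b p b * h b).
Proof.
move=> mm'.
transitivity (\sum_c \prod_k (p ((c : {ffun 'I_M -> X}) k) *
   ((if k == m then g (c k) else 1) * (if k == m' then h (c k) else 1)))).
  apply: eq_bigr => c _; rewrite !big_split /=; congr (_ * (_ * _)).
    by rewrite (bigD1 m) //= eqxx big1 ?mulr1 // => k /negbTE ->.
  by rewrite (bigD1 m') //= eqxx big1 ?mulr1 // => k /negbTE ->.
rewrite (sum_ffun_prod (fun k b => p b *
  ((if k == m then g b else 1) * (if k == m' then h b else 1)))).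
rewrite (bigD1 m) //= (bigD1 m') /=; last by rewrite eq_sym.
rewrite !eqxx (negbTE mm') eq_sym (negbTE mm') [X in _ * (_ * X)]big1 ?mulr1.
  by congr (_ * _); apply: eq_bigr => b _; rewrite ?mulr1 ?mul1r.
move=> k /andP[/negbTE -> /negbTE ->].
by under eq_bigr do rewrite !mulr1; apply: hp.2.
Qed.

Lemma sum_delta_pmf (a : X) : \sum_b p b * (b == a)%:R = p a.
Proof.
by rewrite (bigD1 a) //= eqxx mulr1 big1 ?addr0 // => b /negbTE ->; rewrite mulr0.
Qed.

Lemma empirical_mean b : (0 < M)%N -> \sum_c iid c * empirical c b = p b.
Proof.
move=> M0; under eq_bigr do rewrite /empirical mulr_sumr.
rewrite exchange_big /=.
under eq_bigr => m _.
  under eq_bigr do rewrite mulrCA.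
  rewrite -mulr_sumr (iid_mean1 m (fun a => (a == b)%:R)) sum_delta_pmf.
  over.
by rewrite sumr_const card_ord -[LHS]mulr_natl mulrA divff ?mul1r // pnatr_eq0 -lt0n.
Qed.

Lemma empirical_moment2 a b : (0 < M)%N ->
  \sum_c iid c * (empirical c a * empirical c b) <=
  p a * (M%:R^-1 * (b == a)%:R + p b).
Proof.
move=> M0.
have MR : (0 : R) < M%:R by rewrite ltr0n.
(* Two distinct codewords are independent and give [p a * p b]; a codeword paired with itself gives
   [p a] when [a = b]. Keeping the product term in both cases makes the bound uniform, and this is
   the only loss. *)
have pair (m m' : 'I_M) : \sum_c iid c * ((c m == a)%:R * (c m' == b)%:R) <=
    p a * p b + (m' == m)%:R * (p a * (b == a)%:R).
  have [->|mm'] := eqVneq m' m.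
    under eq_bigr => c _.
      rewrite (_ : (c m == a)%:R * (c m == b)%:R = (b == a)%:R * (c m == a)%:R :> R).
        2: by have [->|_] := eqVneq (c m) a; rewrite ?mulr0n ?mul0r ?mulr0 ?mul1r ?mulr1 1?eq_sym.
      rewrite mulrCA; over.
    rewrite -mulr_sumr (iid_mean1 m (fun d => (d == a)%:R)) sum_delta_pmf mul1r.
    by rewrite [leLHS]mulrC lerDr mulr_ge0 ?hp.1.
  rewrite mul0r addr0.
  rewrite (@iid_mean2 m m' (fun d => (d == a)%:R) (fun d => (d == b)%:R)) 1?eq_sym //.
  by rewrite !sum_delta_pmf.
have -> : \sum_c iid c * (empirical c a * empirical c b) =
   \sum_m \sum_m' M%:R^-1 ^+ 2 * \sum_c iid c * ((c m == a)%:R * (c m' == b)%:R).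
  transitivity (\sum_c \sum_m \sum_m' M%:R^-1 ^+ 2 *
      (iid c * ((c m == a)%:R * (c m' == b)%:R))).
    apply: eq_bigr => c _; rewrite /empirical big_distrlr /= mulr_sumr.
    by apply: eq_bigr => m _; rewrite mulr_sumr; apply: eq_bigr => m' _; ring.
  rewrite exchange_big /=; apply: eq_bigr => m _.
  by rewrite exchange_big /=; apply: eq_bigr => m' _; rewrite mulr_sumr.
apply: (@le_trans _ _ (\sum_(m < M) \sum_(m' < M) M%:R^-1 ^+ 2 *
   (p a * p b + (m' == m)%:R * (p a * (b == a)%:R)))).
  do 2 (apply: ler_sum => ? _).
  by rewrite ler_wpM2l ?exprn_ge0 ?invr_ge0 ?ler0n //.
under eq_bigr => m _.
  rewrite -mulr_sumr big_split /= sumr_const card_ord -mulr_suml.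
  rewrite (bigD1 m) //= eqxx big1 ?addr0 ?mul1r; last by move=> k /negbTE ->.
  over.
rewrite sumr_const card_ord.
set u := p a * p b; set v := p a * (b == a)%:R.
rewrite le_eqVlt; apply/orP; left; apply/eqP.
have -> : p a * (M%:R^-1 * (b == a)%:R + p b) = M%:R^-1 * v + u by rewrite /u /v; ring.
rewrite -[LHS]mulr_natl -[u *+ M]mulr_natl.
by field; rewrite gt_eqF.
Qed.

End RandomCodebook.

(** * One-shot soft covering *)

Section OneShotCovering.
Variables (R : realType) (L : nat) (X Y : finType).
Variables (p : 'I_L -> X -> R) (V : {ffun 'I_L -> X} -> Y -> R) (M : 'I_L -> nat).
Hypothesis hp : forall l, is_pmf (p l).
Hypothesis V0 : forall x y, 0 <= V x y.
Hypothesis V1 : forall x, \sum_y V x y = 1.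
Hypothesis M0 : forall l, (0 < M l)%N.

Let q y := \sum_x pprod p x * V x y.
Let code := {dffun forall l, {ffun 'I_(M l) -> X}}.
Let mu (c : code) : R := \prod_l iid (p l) (c l).
Let emp (c : code) := pprod (fun l => empirical R (c l)).
Let out (c : code) y := \sum_x emp c x * V x y.

(** The exponential of the information density between [X_S] and the output, divided by the number
    of messages of the users in [S]. *)
Definition info_ratio (S : {set 'I_L}) x y : R :=
  (\prod_(l in S) (M l)%:R^-1) * (cond p S (V ^~ y) x / \sum_x' pprod p x' * V x' y).

Let px0 x : 0 <= pprod p x. Proof. exact: (pprod_pmf hp).1. Qed.

Let q0 y : 0 <= q y.
Proof. by apply: sumr_ge0 => x _; rewrite mulr_ge0. Qed.

Let q1 : \sum_y q y = 1.
Proof.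
rewrite /q exchange_big /=; under eq_bigr do rewrite -mulr_sumr V1 mulr1.
exact: (pprod_pmf hp).2.
Qed.

Let mu0 c : 0 <= mu c.
Proof. by apply: prodr_ge0 => l _; apply: iid_ge0. Qed.

Let emp_pmf c : is_pmf (emp c).
Proof.
by apply: pprod_pmf => l; split; [exact: empirical_ge0|exact: empirical_sum].
Qed.

Let mu_pmf : is_pmf mu.
Proof.
split=> //; rewrite (@sum_dffun_prod R _ _ (fun l => iid (p l))) big1 // => l _.
have := iid_mean1 (hp l) (Ordinal (M0 l)) (fun=> 1).
by under eq_bigr do rewrite mulr1; under [RHS]eq_bigr do rewrite mulr1; rewrite (hp l).2.
Qed.

Let emp_mean x : \sum_c mu c * emp c x = pprod p x.
Proof.
transitivity (\sum_(c : code) \prod_l (iid (p l) (c l) * empirical R (c l) (x l))).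
  by apply: eq_bigr => c _; rewrite big_split.
rewrite (@sum_dffun_prod R _ _ (fun l d => iid (p l) d * empirical R d (x l))).
by apply: eq_bigr => l _; rewrite empirical_mean.
Qed.

Let emp_moment x x' : \sum_c mu c * (emp c x * emp c x') <=
  pprod p x * \prod_l ((M l)%:R^-1 * (x' l == x l)%:R + p l (x' l)).
Proof.
have -> : \sum_c mu c * (emp c x * emp c x') = \sum_(c : code) \prod_l
    (iid (p l) (c l) * (empirical R (c l) (x l) * empirical R (c l) (x' l))).
  by apply: eq_bigr => c _; rewrite !big_split.
rewrite (@sum_dffun_prod R _ _
  (fun l d => iid (p l) d * (empirical R d (x l) * empirical R d (x' l)))).
rewrite /pprod -big_split /=; apply: ler_prod => l _.
rewrite empirical_moment2 // andbT; apply: sumr_ge0 => c _.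
by rewrite mulr_ge0 ?iid_ge0 // mulr_ge0 ?empirical_ge0.
Qed.

(** In the expanded product, [S] collects the users whose factor is the coincidence term [1/M]; the
    remaining factors redraw the other inputs, which is exactly the kernel [ker p S]. *)
Let sum_ratio (x : {ffun 'I_L -> X}) y : 0 < q y ->
  \sum_(x' : {ffun 'I_L -> X}) \prod_l ((M l)%:R^-1 * (x' l == x l)%:R + p l (x' l)) * V x' y =
  q y * \sum_S info_ratio S x y.
Proof.
move=> qy; rewrite mulr_sumr.
under eq_bigr do rewrite bigA_distr /= mulr_suml.
rewrite exchange_big /=; apply: eq_bigr => S _.
have -> : q y * info_ratio S x y = (\prod_(l in S) (M l)%:R^-1) * cond p S (V ^~ y) x.
  by rewrite /info_ratio -/(q y) mulrCA [q y * _]mulrC divfK ?gt_eqF.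
rewrite /cond mulr_sumr; apply: eq_bigr => x' _; rewrite mulrA; congr (_ * _).
rewrite [\prod_(l in S) _]big_mkcond /= -big_split /=; apply: eq_bigr => l _.
by case: ifP => _; rewrite ?mul1r.
Qed.

Let info_ratio_set0 x y : 0 < q y -> info_ratio finset.set0 x y = 1.
Proof.
by move=> qy; rewrite /info_ratio big_set0 mul1r cond_set0 divff // gt_eqF.
Qed.

Lemma info_ratio_ge0 S x y : 0 <= info_ratio S x y.
Proof.
rewrite mulr_ge0 //; first by apply: prodr_ge0.
by rewrite divr_ge0 // ?q0 // cond_ge0.
Qed.

Let ratio x y := \sum_S info_ratio S x y.

Let ratio_ge1 x y : 0 < q y -> 1 <= ratio x y.
Proof.
move=> qy; rewrite /ratio (bigD1 finset.set0) //= info_ratio_set0 // lerDl.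
by apply: sumr_ge0 => S _; apply: info_ratio_ge0.
Qed.

Let q_gt0 x y : 0 < pprod p x * V x y -> 0 < q y.
Proof.
by move=> h; rewrite /q (bigD1 x) //= ltr_pwDl // sumr_ge0 // => *; rewrite mulr_ge0.
Qed.

(** Jensen's inequality before averaging: the logarithm is bounded by its tangent at [ratio x y],
    which does not depend on the codebook [c]. *)
Let pointwise c x y :
  mu c * (emp c x * V x y * ln (out c y / q y)) <=
  mu c * emp c x * V x y * (ln (ratio x y) - 1) +
  V x y / (q y * ratio x y) * (mu c * (emp c x * out c y)).
Proof.
have [px Ex] := emp_pmf c.
have out0 : 0 <= out c y by apply: sumr_ge0 => x' _; rewrite mulr_ge0.
have [h|h] := eqVneq (mu c * emp c x * V x y) 0.
  rewrite mulrA mulrA h !mul0r add0r !mulr_ge0 // ?invr_ge0 ?mulr_ge0 //.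
  by apply: sumr_ge0 => S _; apply: info_ratio_ge0.
have hgt : 0 < mu c * emp c x * V x y by rewrite lt_def h !mulr_ge0.
have Vx : 0 < V x y by rewrite lt_def V0 andbT; apply: contra h => /eqP ->; rewrite mulr0.
have mue : 0 < mu c * emp c x by rewrite -(pmulr_lgt0 _ Vx).
have pxg : 0 < pprod p x.
  rewrite -emp_mean (bigD1 c) //= ltr_pwDl // sumr_ge0 // => d _.
  by rewrite mulr_ge0 // (emp_pmf d).1.
have qy : 0 < q y by apply: (@q_gt0 x); rewrite mulr_gt0.
have mug : 0 < mu c.
  by rewrite lt_def mu0 andbT; apply: contraTneq mue => ->; rewrite mul0r ltxx.
have eg : 0 < emp c x by rewrite -(pmulr_rgt0 _ mug).
have og : 0 < out c y.
  rewrite /out (bigD1 x) //= ltr_pwDl ?mulr_gt0 // sumr_ge0 // => x' _.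
  by rewrite mulr_ge0.
have rg : 0 < ratio x y by apply: (lt_le_trans ltr01); apply: ratio_ge1.
have := ln_le_tangent (divr_gt0 og qy) rg.
rewrite -(ler_pM2l hgt) => hh.
rewrite mulrA mulrA; apply: (le_trans hh).
rewrite le_eqVlt; apply/orP; left; apply/eqP.
by field; rewrite !gt_eqF.
Qed.

Let divergence_le :
  \sum_c mu c * (\sum_y out c y * ln (out c y / q y)) <=
  \sum_x \sum_y pprod p x * V x y * ln (ratio x y).
Proof.
have -> : \sum_c mu c * (\sum_y out c y * ln (out c y / q y)) =
    \sum_c \sum_x \sum_y mu c * (emp c x * V x y * ln (out c y / q y)).
  apply: eq_bigr => c _; rewrite mulr_sumr exchange_big /=; apply: eq_bigr => y _.
  by rewrite /out mulr_suml mulr_sumr.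
apply: (@le_trans _ _ (\sum_c \sum_x \sum_y
  (mu c * emp c x * V x y * (ln (ratio x y) - 1) +
   V x y / (q y * ratio x y) * (mu c * (emp c x * out c y))))).
  by do 3 (apply: ler_sum => ? _); apply: pointwise.
rewrite exchange_big /=.
under eq_bigr => x _.
  rewrite exchange_big /=.
  under eq_bigr => y _.
    rewrite big_split /= -mulr_suml -mulr_suml emp_mean -mulr_sumr.
    over.
  over.
(* By the second moment bound, the linear part of the tangent averages to at most
   [pprod p x * V x y], which cancels the [- 1] next to [ln (ratio x y)]. *)
have key x y : V x y / (q y * ratio x y) * \sum_c mu c * (emp c x * out c y)
    <= pprod p x * V x y.
  have r0 : 0 <= ratio x y by apply: sumr_ge0 => S _; apply: info_ratio_ge0.
  have [qy|qy] := eqVneq (q y) 0.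
    by rewrite qy mul0r invr0 mulr0 mul0r mulr_ge0.
  have qg : 0 < q y by rewrite lt_def qy q0.
  have rg : 0 < ratio x y by apply: (lt_le_trans ltr01); apply: ratio_ge1.
  have hs : \sum_c mu c * (emp c x * out c y) <= pprod p x * (q y * ratio x y).
    have -> : \sum_c mu c * (emp c x * out c y) =
        \sum_x' (\sum_c mu c * (emp c x * emp c x')) * V x' y.
      transitivity (\sum_c \sum_x' mu c * (emp c x * emp c x') * V x' y).
        apply: eq_bigr => c _; rewrite /out !mulr_sumr; apply: eq_bigr => x' _; ring.
      by rewrite exchange_big /=; apply: eq_bigr => x' _; rewrite mulr_suml.
    rewrite -sum_ratio // mulr_sumr; apply: ler_sum => x' _.
    by rewrite mulrA ler_wpM2r // emp_moment.
  rewrite mulrAC ler_pdivrMr ?mulr_gt0 //.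
  by apply: (le_trans (ler_wpM2l (V0 x y) hs)); rewrite mulrCA mulrA.
apply: (@le_trans _ _ (\sum_x \sum_y
  (pprod p x * V x y * (ln (ratio x y) - 1) + pprod p x * V x y))).
  by do 2 (apply: ler_sum => ? _); rewrite lerD2l.
apply: ler_sum => x _; apply: ler_sum => y _.
by rewrite mulrBr mulr1 subrK.
Qed.

Lemma one_shot_covering (r lam : R) : 0 < r -> r <= 1 -> 0 < lam ->
  exists c : code,
    \sum_y `|out c y - q y| <=
    2 * lam + (2 * lam)^-1 * \sum_x \sum_y pprod p x * V x y *
      \sum_(S | S != finset.set0) r^-1 * info_ratio S x y `^ r.
Proof.
move=> r0 r1 lam0; apply: (avg_exists mu_pmf).
have tv c : mu c * \sum_y `|out c y - q y| <=
    mu c * (2 * lam) + (2 * lam)^-1 * (mu c * \sum_y out c y * ln (out c y / q y)).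
  have [->|mun] := eqVneq (mu c) 0; first by rewrite !mul0r mulr0 addr0.
  have mug : 0 < mu c by rewrite lt_def mun mu0.
  have [px Ex] := emp_pmf c.
  have out0 y : 0 <= out c y by apply: sumr_ge0 => x' _; rewrite mulr_ge0.
  have out1 : \sum_y out c y = 1.
    by rewrite /out exchange_big /=; under eq_bigr do rewrite -mulr_sumr V1 mulr1.
  rewrite [(2 * lam)^-1 * _]mulrCA -mulrDr ler_pM2l //.
  apply: (@le_trans _ _ (\sum_y ((2 * lam)^-1 *
     (out c y * ln (out c y / q y) - out c y + q y) + lam * (out c y + q y)))).
    (* Absolute continuity: for a codebook of positive probability, [emp c x > 0] forces
       [pprod p x > 0], so an output with [q y = 0] is not produced by the code either. *)
    apply: ler_sum => y _; apply: abs_sub_le_divergence => // qy.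
    apply: big1 => x _; have [->|ne] := eqVneq (emp c x) 0; first by rewrite mul0r.
    have eg : 0 < emp c x by rewrite lt_def ne px.
    have pxg : 0 < pprod p x.
      rewrite -emp_mean (bigD1 c) //= ltr_pwDl ?mulr_gt0 // sumr_ge0 // => d _.
      by rewrite mulr_ge0 // (emp_pmf d).1.
    have /eqP := qy; rewrite psumr_eq0; last by move=> ? _; rewrite mulr_ge0.
    move/allP/(_ x (mem_index_enum x)); rewrite /= mulf_eq0 (gt_eqF pxg) /= => /eqP ->.
    by rewrite mulr0.
  rewrite big_split /= -!mulr_sumr !big_split /= sumrN out1 q1 -addrA addNr addr0.
  by rewrite le_eqVlt; apply/orP; left; apply/eqP; ring.
apply: (le_trans (ler_sum _ (fun c _ => tv c))).
rewrite big_split /= -mulr_suml mu_pmf.2 mul1r lerD2l -mulr_sumr.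
rewrite ler_pM2l ?invr_gt0 ?mulr_gt0 //.
apply: (le_trans divergence_le); apply: ler_sum => x _; apply: ler_sum => y _.
have [->|h] := eqVneq (pprod p x * V x y) 0; first by rewrite !mul0r.
have hgt : 0 < pprod p x * V x y by rewrite lt_def h mulr_ge0.
have qy := q_gt0 hgt.
(* The empty set supplies the 1 in [ln (1 + a)]; each nonempty [S] is then traded for a moment of
   order [r]. *)
rewrite ler_pM2l // /ratio (bigD1 finset.set0) //= info_ratio_set0 //.
apply: le_trans (ln1D_sum _) _ => [S _|]; first exact: info_ratio_ge0.
by apply: ler_sum => S _; apply: ln1D_le_powR => //; exact: info_ratio_ge0.
Qed.

End OneShotCovering.

(** * The conditional mutual information *)

Section Gibbs.
Variables (R : realType) (L : nat) (X Y : finType).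

(** Among channels that see only [X_S], the averaged channel [cond p S V] has the largest expected
    log-likelihood. Indeed [ln (U / V_S) <= U / V_S - 1], and by the tower rule the ratio has mean
    at most 1. *)
Lemma gibbs_cond (p : 'I_L -> X -> R) (S : {set 'I_L})
    (V U : {ffun 'I_L -> X} -> Y -> R) :
  (forall l, is_pmf (p l)) -> (forall x y, 0 <= V x y) ->
  (forall x, \sum_y V x y = 1) ->
  (forall x y, 0 <= U x y) -> (forall x, \sum_y U x y = 1) ->
  (forall (x x' : {ffun 'I_L -> X}) y,
     (forall l, l \in S -> x' l = x l) -> U x' y = U x y) ->
  (forall x y, 0 < pprod p x * V x y -> 0 < U x y) ->
  \sum_x \sum_y pprod p x * V x y * ln (U x y) <=
  \sum_x \sum_y pprod p x * V x y * ln (cond p S (V ^~ y) x).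
Proof.
move=> hp V0 V1 U0 U1 Uagree Upos; have [px0 px1] := pprod_pmf hp.
have c0 x y : 0 <= cond p S (V ^~ y) x by apply: cond_ge0.
have h1 : \sum_x \sum_y pprod p x * V x y * (U x y / cond p S (V ^~ y) x) <= 1.
  rewrite exchange_big /=.
  under eq_bigr => y _.
    rewrite -(@cond_tower R L _ p S (V ^~ y) (fun x => U x y / cond p S (V ^~ y) x)) //.
      over.
    by move=> x x' h; rewrite (cond_agree _ _ h) (Uagree _ _ _ h).
  rewrite exchange_big /= -px1; apply: ler_sum => x _.
  rewrite -[leRHS]mulr1 -(U1 x) mulr_sumr; apply: ler_sum => y _.
  rewrite -mulrA ler_wpM2l // mulrCA.
  have [->|cn] := eqVneq (cond p S (V ^~ y) x) 0; first by rewrite mul0r mulr0.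
  by rewrite divff // mulr1.
have h2 : \sum_x \sum_y pprod p x * V x y = 1.
  by under eq_bigr do rewrite -mulr_sumr V1 mulr1.
rewrite -subr_le0 -sumrB.
apply: (@le_trans _ _ (\sum_x \sum_y pprod p x * V x y *
  (U x y / cond p S (V ^~ y) x - 1))); last first.
  under eq_bigr do under eq_bigr do rewrite mulrBr mulr1.
  by under eq_bigr do rewrite sumrB; rewrite sumrB h2 subr_le0.
apply: ler_sum => x _; rewrite -sumrB; apply: ler_sum => y _; rewrite -mulrBr.
have [->|h] := eqVneq (pprod p x * V x y) 0; first by rewrite !mul0r.
have hgt : 0 < pprod p x * V x y by rewrite lt_def h mulr_ge0.
have cg := cond_gt0 S hp (V0^~ y) hgt.
have ug := Upos _ _ hgt.
by rewrite ler_pM2l // -ln_div ?posrE // ln_le_subr1 // divr_gt0.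
Qed.

End Gibbs.

Section Information.
Variables (R : realType) (L : nat) (Z : finType).
Implicit Types (W : inp L -> Z -> R) (q : 'I_L -> bool -> R) (S : {set 'I_L}).

(* The density is normalized by the target [qZ], not by the output law of [q]:
   this is the mutual information only when the two coincide, but it stays
   continuous in [q] when they are merely close. *)
Definition info W (qZ : Z -> R) q S : R :=
  \sum_x \sum_z pprod q x * W x z * (ln (cond q S (W ^~ z) x) - ln (qZ z)).

Lemma out_distE W q z : out_dist W q z = \sum_x pprod q x * W x z.
Proof. by apply: eq_bigr => x _; rewrite mulrC. Qed.

Lemma restr_eq S (x x' : inp L) :
  (restr S x' == restr S x) = [forall l in S, x' l == x l].
Proof.
apply/eqP/forall_inP => [h l lS|h].
  by have /ffunP/(_ l) := h; rewrite !ffunE lS => ->.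
by apply/ffunP => l; rewrite !ffunE; case: ifP => // lS; rewrite (eqP (h l lS)).
Qed.

Lemma sum_restr_fiber q S (g : inp L -> R) x :
  \sum_(x' | restr S x' == restr S x) pprod q x' * g x' =
  (\prod_(l in S) q l (x l)) * cond q S g x.
Proof.
rewrite /cond mulr_sumr big_mkcond /=; apply: eq_bigr => x' _.
rewrite restr_eq mulrA [X in _ = X * _](_ : _ =
  if [forall l in S, x' l == x l] then pprod q x' else 0); last first.
  rewrite big_mkcond /= -big_split /=; case: ifPn => [/forall_inP h|].
    apply: eq_bigr => l _; case: ifP => lS; last by rewrite mul1r.
    by rewrite (h l lS) mulr1 (eqP (h l lS)).
  rewrite negb_forall_in => /exists_inP[l lS /negbTE nl].
  by rewrite (bigD1 l) //= lS nl mulr0 mul0r.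
by case: ifP; rewrite ?mul0r.
Qed.

Lemma sum_fibers (A B : finType) (f : A -> B) (F : A -> R) :
  \sum_b \sum_(a | f a == b) F a = \sum_a F a.
Proof. by rewrite [RHS](partition_big f predT). Qed.

(** On a fiber of [restr S], the joint law is [pT t] times the mass of [x_S] times the averaged
    channel. The first two factors cancel inside the logarithm, leaving [W_S / qZ]; the factor
    [1 / ln 2] converts nats to bits. *)
Lemma MI_info (T : finType) W qZ (pT : T -> R) (qXT : 'I_L -> T -> bool -> R) S :
  is_channel W -> (forall l t, is_pmf (qXT l t)) ->
  (forall t z, qZ z = out_dist W (fun l => qXT l t) z) ->
  MI_XS_Z_T W pT qXT S =
  (ln 2)^-1 * \sum_t pT t * info W qZ (fun l => qXT l t) S.
Proof.
move=> [W0 W1] hq hout; rewrite /MI_XS_Z_T /cmi mulr_sumr; apply: eq_bigr => t _.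
set q := fun l => qXT l t.
have hq' : forall l, is_pmf (q l) by move=> l; apply: hq.
have pE a z : joint_TXSZ W pT qXT S t a z =
    \sum_(x | restr S x == a) pT t * (pprod q x * W x z).
  by apply: eq_bigr => x _; rewrite mulrA.
have [pT0|pTn] := eqVneq (pT t) 0.
  rewrite pT0 mul0r mulr0 big1 // => a _; rewrite big1 // => z _.
  by rewrite [X in X * _]pE big1 ?mul0r // => x _; rewrite pT0 mul0r.
have px0 : forall x, 0 <= pprod q x := (pprod_pmf hq').1.
have pSZ z : \sum_a joint_TXSZ W pT qXT S t a z = pT t * qZ z.
  under eq_bigr do rewrite pE.
  rewrite sum_fibers (hout t) out_distE mulr_sumr.
  by [].
have qZ1 : \sum_z qZ z = 1.
  under eq_bigr do rewrite (hout t) out_distE.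
  rewrite exchange_big /=; under eq_bigr do rewrite -mulr_sumr W1 mulr1.
  exact: (pprod_pmf hq').2.
have pall : \sum_a \sum_z joint_TXSZ W pT qXT S t a z = pT t.
  rewrite exchange_big /=; under eq_bigr do rewrite pSZ.
  by rewrite -mulr_sumr qZ1 mulr1.
rewrite pall.
pose A a z := log2 (joint_TXSZ W pT qXT S t a z * pT t /
  ((\sum_b' joint_TXSZ W pT qXT S t a b') * (pT t * qZ z))).
transitivity (\sum_z \sum_a \sum_(x | restr S x == a)
    pT t * (pprod q x * W x z) * A (restr S x) z).
  rewrite exchange_big /=; apply: eq_bigr => z _; apply: eq_bigr => a _.
  rewrite pSZ -/(A a z) pE mulr_suml; apply: eq_bigr => x /eqP -> //.
rewrite /info [in RHS]exchange_big /= mulrA mulr_sumr; apply: eq_bigr => z _.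
rewrite sum_fibers mulr_sumr; apply: eq_bigr => x _.
have [h|h] := eqVneq (pprod q x * W x z) 0; first by rewrite h mulr0 !mul0r mulr0.
have hgt : 0 < pprod q x * W x z by rewrite lt_def h mulr_ge0.
have cg := cond_gt0 S hq' (W0^~ z) hgt.
have qg : 0 < qZ z.
  rewrite (hout t) out_distE (bigD1 x) //= ltr_pwDl // sumr_ge0 // => *.
  by rewrite mulr_ge0.
set pS := \prod_(l in S) q l (x l).
have pSn : pS != 0.
  apply/prodf_neq0 => l lS; apply: contra h => /eqP ql.
  by rewrite /pprod (bigD1 l) //= ql !mul0r.
have e1 z' : joint_TXSZ W pT qXT S t (restr S x) z' =
    pT t * (pS * cond q S (W ^~ z') x).
  by rewrite pE -mulr_sumr sum_restr_fiber.
have -> : A (restr S x) z = log2 (cond q S (W ^~ z) x / qZ z).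
  rewrite /A; congr log2; under eq_bigr do rewrite e1.
  rewrite -!mulr_sumr cond_sum // e1.
  by field; rewrite pTn pSn (gt_eqF qg).
rewrite /log2 ln_div ?posrE //; ring.
Qed.

Definition cond_ratio W (qZ : Z -> R) q S x z : R := cond q S (W ^~ z) x / qZ z.

(** Moment generating function of the information density, of Rényi type; its slope at [r = 0] is
    the mutual information. *)
Definition renyi W (qZ : Z -> R) q S (r : R) : R :=
  \sum_x \sum_z pprod q x * W x z * (cond_ratio W qZ q S x z) `^ r.

(** From [exp (-u) >= 1 - u] one gets [exp u <= 1 / (1 - u)], and [(1 - u)(1 + u + 2 u^2) = 1 + u^2
    (1 - 2 u) >= 1]. *)
Lemma expR_le_quad (u : R) : u <= 2^-1 -> expR u <= 1 + u + 2 * u ^+ 2.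
Proof.
move=> hu; have := expR_ge1Dx (- u); rewrite expRN => h.
have e0 := expR_gt0 u.
have h1 : (1 - u) * expR u <= 1.
  by rewrite -(ler_pM2r e0) mulVf ?gt_eqF // in h.
have h2 : 1 <= (1 - u) * (1 + u + 2 * u ^+ 2).
  have := sqr_ge0 u; nra.
rewrite -(@ler_pM2l _ (1 - u)); lra.
Qed.

Lemma renyi_le W qZ q S (r K : R) :
  is_channel W -> (forall l, is_pmf (q l)) -> (forall z, qZ z = out_dist W q z) ->
  0 <= r -> r * K <= 2^-1 ->
  (forall x z, `|ln (cond_ratio W qZ q S x z)| <= K) ->
  renyi W qZ q S r <= 1 + r * info W qZ q S + 2 * (r * K) ^+ 2.
Proof.
move=> [W0 W1] hq hout r0 rK hK.
have px0 : forall x, 0 <= pprod q x := (pprod_pmf hq).1.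
have tot (c : R) : c = \sum_x \sum_z pprod q x * W x z * c.
  under eq_bigr do rewrite -mulr_suml -mulr_sumr W1 mulr1.
  by rewrite -mulr_suml (pprod_pmf hq).2 mul1r.
have -> : 1 + r * info W qZ q S + 2 * (r * K) ^+ 2 =
    (\sum_x \sum_z pprod q x * W x z * 1) + r * info W qZ q S +
    \sum_x \sum_z pprod q x * W x z * (2 * (r * K) ^+ 2) by rewrite -!tot.
rewrite /info mulr_sumr -!big_split /=; apply: ler_sum => x _.
rewrite mulr_sumr -!big_split /=; apply: ler_sum => z _.
have [->|h] := eqVneq (pprod q x * W x z) 0; first by rewrite !mul0r mulr0 !addr0.
have hgt : 0 < pprod q x * W x z by rewrite lt_def h mulr_ge0.
have cg := cond_gt0 S hq (W0^~ z) hgt.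
have qg : 0 < qZ z.
  rewrite hout out_distE (bigD1 x) //= ltr_pwDl // sumr_ge0 // => *.
  by rewrite mulr_ge0.
have hc : 0 < cond_ratio W qZ q S x z by rewrite divr_gt0.
rewrite -ln_div ?posrE // -/(cond_ratio W qZ q S x z).
rewrite [r * (_ * _)]mulrCA -!mulrDr ler_pM2l //.
rewrite /powR gt_eqF //; set l := ln _.
have lK : `|l| <= K := hK x z.
have [l1 l2] : - K <= l /\ l <= K by apply/andP; rewrite -ler_norml.
have l3 : r * l <= r * K by rewrite ler_wpM2l.
apply: (le_trans (expR_le_quad _)); first by lra.
rewrite lerD2l ler_pM2l // -[leLHS]real_normK ?num_real // lerXn2r ?nnegrE //.
  by rewrite mulr_ge0 // (le_trans (normr_ge0 l)).
by rewrite normrM (ger0_norm r0) ler_wpM2l.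
Qed.

End Information.

(** * Memoryless blocks *)

Lemma powR_prod (R : realType) (I : finType) (P : pred I) (a : I -> R) (r : R) :
  (forall i, 0 <= a i) -> (\prod_(i | P i) a i) `^ r = \prod_(i | P i) a i `^ r.
Proof.
move=> a0; have [] // : 0 <= \prod_(i | P i) a i /\
  (\prod_(i | P i) a i) `^ r = \prod_(i | P i) a i `^ r.
apply: (big_rec2 (fun s t => 0 <= s /\ s `^ r = t)); first by rewrite powR1.
by move=> i s t _ [s0 <-]; rewrite mulr_ge0 // powRM.
Qed.

Section Blocks.
Variables (R : realType) (L : nat) (Z : finType) (W : inp L -> Z -> R) (N : nat).
Hypothesis hW : is_channel W.
Let blk := {ffun 'I_N -> bool}.

Definition block_channel (x : {ffun 'I_L -> blk}) (y : {ffun 'I_N -> Z}) : R :=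
  \prod_i W (slice x i) (y i).

Lemma block_channel_ge0 x y : 0 <= block_channel x y.
Proof. by apply: prodr_ge0 => i _; apply: hW.1. Qed.

Lemma block_channel_sum x : \sum_y block_channel x y = 1.
Proof.
rewrite /block_channel (sum_ffun_prod (fun i z => W (slice x i) z)).
by rewrite big1 // => i _; apply: hW.2.
Qed.

(** Connects the code to both directions of the proof: uniform messages push forward to independent
    empirical laws of codewords, fed into the block channel. *)
Lemma code_outE (M : 'I_L -> nat) (f : forall l, 'I_(M l) -> blk) y :
  code_out W f y =
  \sum_x pprod (fun l b => \sum_m (M l)%:R^-1 * (f l m == b)%:R) x *
         block_channel x y.
Proof.
rewrite /code_out -prodfV mulr_sumr.
rewrite -(@pushforward_dffun R _ _ _ (fun l _ => (M l)%:R^-1) f (block_channel ^~ y)).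
apply: eq_bigr => s _; congr (_ * _); apply: eq_bigr => i _; congr (W _ _).
by apply/ffunP => l; rewrite !ffunE.
Qed.

Section Memoryless.
Variable q : 'I_N -> 'I_L -> bool -> R.
Hypothesis hq : forall i l, is_pmf (q i l).

Definition block_pmf (l : 'I_L) (b : blk) : R := \prod_i q i l (b i).

Lemma block_pmfP l : is_pmf (block_pmf l).
Proof.
split=> [b|]; first by apply: prodr_ge0 => i _; apply: (hq i l).1.
by rewrite (sum_ffun_prod (fun i => q i l)) big1 // => i _; apply: (hq i l).2.
Qed.

Lemma pprod_block x : pprod block_pmf x = \prod_i pprod (q i) (slice x i).
Proof.
rewrite /pprod /block_pmf exchange_big /=; apply: eq_bigr => i _.
by apply: eq_bigr => l _; rewrite ffunE.
Qed.

Lemma ker_block S x x' :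
  ker block_pmf S x x' = \prod_i ker (q i) S (slice x i) (slice x' i).
Proof.
rewrite /ker exchange_big /=; apply: eq_bigr => l _.
rewrite /slice; under eq_bigr do rewrite !ffunE.
by case: (l \in S); rewrite // prod_delta.
Qed.

Lemma cond_block S x y : cond block_pmf S (block_channel ^~ y) x =
  \prod_i cond (q i) S (W ^~ (y i)) (slice x i).
Proof.
rewrite -(sum_slice_prod
  (fun i a => ker (q i) S (slice x i) a * W a (y i))).
by apply: eq_bigr => x' _; rewrite ker_block -big_split.
Qed.

Lemma out_block y : \sum_x pprod block_pmf x * block_channel x y =
  \prod_i out_dist W (q i) (y i).
Proof.
under [RHS]eq_bigr do rewrite out_distE.
rewrite -(sum_slice_prod (fun i a => pprod (q i) a * W a (y i))).
by apply: eq_bigr => x _; rewrite pprod_block -big_split.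
Qed.

Lemma info_ratio_block (qZ : Z -> R) (M : 'I_L -> nat) S (r : R) :
  (forall i z, qZ z = out_dist W (q i) z) ->
  \sum_x \sum_y pprod block_pmf x * block_channel x y *
     info_ratio block_pmf block_channel M S x y `^ r =
  (\prod_(l in S) (M l)%:R^-1) `^ r * \prod_i renyi W qZ (q i) S r.
Proof.
move=> hqZ; have qZ0 z (i : 'I_N) : 0 <= qZ z.
  rewrite (hqZ i) out_distE sumr_ge0 // => x _.
  by rewrite mulr_ge0 ?(hW.1) // (pprod_pmf (hq i)).1.
pose F i a z := pprod (q i) a * W a z * (cond_ratio W qZ (q i) S a z) `^ r.
have -> : \prod_i renyi W qZ (q i) S r =
    \sum_(x : {ffun 'I_L -> blk}) \sum_(y : {ffun 'I_N -> Z})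
       \prod_i F i (slice x i) (y i).
  under [RHS]eq_bigr => x _ do rewrite (sum_ffun_prod (fun i => F i (slice x i))).
  by rewrite (sum_slice_prod (fun i a => \sum_z F i a z)).
rewrite mulr_sumr; apply: eq_bigr => x _; rewrite mulr_sumr; apply: eq_bigr => y _.
rewrite /F big_split big_split /= -pprod_block mulrCA; congr (_ * _).
rewrite /info_ratio cond_block out_block -prodf_div.
have c0 i : 0 <= cond_ratio W qZ (q i) S (slice x i) (y i).
  by rewrite divr_ge0 ?(qZ0 _ i) // cond_ge0 // => a; apply: hW.1.
rewrite powRM; first last.
- by apply: prodr_ge0 => i _; rewrite -(hqZ i); apply: c0.
- by apply: prodr_ge0.
congr (_ * _); rewrite -powR_prod //; congr (_ `^ _).
by apply: eq_bigr => i _; rewrite -(hqZ i).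
Qed.

End Memoryless.

(** A fixed time-sharing sequence [t] is selected by averaging the covering bound, whose product
    over letters becomes an [N]-th power for i.i.d. [t]. Any [t] has the same target output, so
    fixing it is legitimate. *)
Lemma exists_code (T : finType) (pT : T -> R) (qXT : 'I_L -> T -> bool -> R)
    (qZ : Z -> R) (M : 'I_L -> nat) (r lam : R) :
  is_pmf pT -> (forall l t, is_pmf (qXT l t)) ->
  (forall t z, qZ z = out_dist W (fun l => qXT l t) z) ->
  (forall l, (0 < M l)%N) -> 0 < r -> r <= 1 -> 0 < lam ->
  exists f : forall l, 'I_(M l) -> blk,
    tvd (code_out W f) (fun y : {ffun 'I_N -> Z} => \prod_i qZ (y i)) <=
    2 * lam + (2 * lam)^-1 * (r^-1 * \sum_(S | S != finset.set0)
      (\prod_(l in S) (M l)%:R^-1) `^ r *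
      (\sum_t pT t * renyi W qZ (fun l => qXT l t) S r) ^+ N).
Proof.
move=> hT hq hout M0 r0 r1 lam0.
pose B (t : {ffun 'I_N -> T}) := r^-1 * \sum_(S | S != finset.set0)
  (\prod_(l in S) (M l)%:R^-1) `^ r *
  \prod_i renyi W qZ (fun l => qXT l (t i)) S r.
pose w (t : {ffun 'I_N -> T}) := \prod_i pT (t i).
have hw : is_pmf w.
  split=> [t|]; first by apply: prodr_ge0 => i _; apply: hT.1.
  by rewrite (sum_ffun_prod (fun=> pT)) big1 // => i _; apply: hT.2.
have [t ht] : exists t, B t <= r^-1 * \sum_(S | S != finset.set0)
      (\prod_(l in S) (M l)%:R^-1) `^ r *
      (\sum_t pT t * renyi W qZ (fun l => qXT l t) S r) ^+ N.
  apply: (avg_exists hw); rewrite le_eqVlt; apply/orP; left; apply/eqP.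
  under eq_bigr do rewrite /B mulrCA mulr_sumr.
  rewrite -mulr_sumr exchange_big /=; congr (_ * _); apply: eq_bigr => S _.
  under eq_bigr do rewrite mulrCA -big_split.
  rewrite -mulr_sumr; congr (_ * _).
  rewrite (sum_ffun_prod (fun _ t => pT t * renyi W qZ (fun l => qXT l t) S r)).
  by rewrite prodr_const card_ord.
pose q i l := qXT l (t i).
have hqi i l : is_pmf (q i l) by apply: hq.
have [c hc] := one_shot_covering (block_pmfP hqi) block_channel_ge0
  block_channel_sum M0 r0 r1 lam0.
exists (fun l => c l).
have -> : tvd (code_out W (fun l => c l)) (fun y : {ffun 'I_N -> Z} => \prod_i qZ (y i)) =
   \sum_y `|\sum_x pprod (fun l => empirical R (c l)) x * block_channel x y -
            \sum_x pprod (block_pmf q) x * block_channel x y|.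
  apply: eq_bigr => y _; rewrite code_outE out_block; congr (`|_ - _|).
  by apply: eq_bigr => i _; rewrite (hout (t i)).
apply: (le_trans hc); rewrite lerD2l ler_pM2l ?invr_gt0 ?mulr_gt0 //.
apply: le_trans ht; rewrite le_eqVlt; apply/orP; left; apply/eqP.
rewrite /B mulr_sumr.
under [LHS]eq_bigr => x _ do under eq_bigr => y _ do rewrite mulr_sumr.
under [LHS]eq_bigr => x _ do rewrite exchange_big /=.
rewrite exchange_big /=; apply: eq_bigr => S _.
rewrite -(@info_ratio_block q hqi qZ); last by move=> i z; apply: hout.
rewrite mulr_sumr; apply: eq_bigr => x _.
by rewrite mulr_sumr; apply: eq_bigr => y _; rewrite mulrCA.
Qed.

End Blocks.

(** * Achievability *)

Lemma term_le_sum (R : numDomainType) (I : finType) (F : I -> R) i :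
  (forall i, 0 <= F i) -> F i <= \sum_i F i.
Proof. by move=> F0; rewrite (bigD1 i) //= lerDl sumr_ge0. Qed.

Section Achievability.
Variables (R : realType) (L : nat) (Z : finType) (W : inp L -> Z -> R) (qZ : Z -> R).
Hypothesis hW : is_channel W.

Lemma ln2_gt0 : (0 : R) < ln 2.
Proof. by apply: ln_gt0; lra. Qed.

Lemma info_ge0 (q : 'I_L -> bool -> R) S :
  (forall l, is_pmf (q l)) -> (forall z, qZ z = out_dist W q z) ->
  0 <= info W qZ q S.
Proof.
move=> hq hout; have [px0 px1] := pprod_pmf hq.
have [W0 W1] := hW.
have qZ0 z : 0 <= qZ z.
  by rewrite hout out_distE sumr_ge0 // => x _; rewrite mulr_ge0.
have qZ1 : \sum_z qZ z = 1.
  under eq_bigr do rewrite hout out_distE.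
  by rewrite exchange_big /=; under eq_bigr do rewrite -mulr_sumr W1 mulr1.
have qg x z : 0 < pprod q x * W x z -> 0 < qZ z.
  by move=> h; rewrite hout out_distE (bigD1 x) //= ltr_pwDl // sumr_ge0 // => *;
    rewrite mulr_ge0.
have := @gibbs_cond R L _ Z q S W (fun=> qZ) hq W0 W1 (fun=> qZ0) (fun=> qZ1)
  (fun _ _ _ _ => erefl) qg.
rewrite -subr_ge0 -sumrB /info => /le_trans; apply.
rewrite le_eqVlt; apply/orP; left; apply/eqP; apply: eq_bigr => x _.
by rewrite -sumrB; apply: eq_bigr => z _; rewrite mulrBr.
Qed.

Lemma msize_gt0 (r : 'I_L -> R) N l : 0 < r l -> (0 < msize r N l)%N.
Proof.
move=> rl; rewrite /msize truncn_gt0.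
have := @ler_powR R 2 ltac:(lra) 0 (N%:R * r l).
by rewrite powRr0; apply; rewrite mulr_ge0 // ltW.
Qed.

(** The factor 2 pays for the truncation: the message count [m] is at least 1, so
    [2 ^ (N r) < m + 1 <= 2 m]. *)
Lemma msize_inv_le (r : 'I_L -> R) N l : 0 < r l ->
  (msize r N l)%:R^-1 <= 2 * expR (- (N%:R * r l * ln 2)).
Proof.
move=> rl; have m0 := msize_gt0 N rl.
set u := expR (N%:R * r l * ln 2).
have uE : (2 : R) `^ (N%:R * r l) = u by rewrite /powR gt_eqF //; lra.
have h := truncnS_gt ((2 : R) `^ (N%:R * r l)).
rewrite uE -natr1 in h.
have m1 : (1 : R) <= (msize r N l)%:R by rewrite ler1n.
have mE : (msize r N l)%:R = (Num.truncn u)%:R :> R by rewrite /msize uE.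
have u0 : 0 < u := expR_gt0 _.
rewrite expRN -/u ler_pdivlMr // mulrC ler_pdivrMr ?(lt_le_trans ltr01) //.
lra.
Qed.

Lemma achievable_gt (T : finType) (pT : T -> R) (qXT : 'I_L -> T -> bool -> R)
    (r : 'I_L -> R) (d : R) :
  is_pmf pT -> (forall l t, is_pmf (qXT l t)) ->
  (forall t z, qZ z = out_dist W (fun l => qXT l t) z) ->
  0 < d -> (forall l, 0 < r l) ->
  (forall S, S != finset.set0 ->
    \sum_t pT t * info W qZ (fun l => qXT l t) S + d <= ln 2 * \sum_(l in S) r l) ->
  achievable W qZ r.
Proof.
move=> hT hq hout d0 r0 hr.
(* A crude uniform bound on all log-ratios, finite because [ln 0 = 0]. *)
pose K' : R := \sum_t \sum_S \sum_x \sum_z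
  `|ln (cond_ratio W qZ (fun l => qXT l t) S x z)|.
pose K := 1 + K'.
have hK t S x z : `|ln (cond_ratio W qZ (fun l => qXT l t) S x z)| <= K.
  apply: (@le_trans _ _ K'); last by rewrite /K lerDr ler01.
  apply: le_trans (term_le_sum t _); last by move=> *; do 3 (apply: sumr_ge0 => ? _).
  apply: le_trans (term_le_sum S _); last by move=> *; do 2 (apply: sumr_ge0 => ? _).
  apply: le_trans (term_le_sum x _); last by move=> *; apply: sumr_ge0 => ? _.
  exact: term_le_sum z _.
have K1 : 1 <= K by rewrite lerDl; do 4 (apply: sumr_ge0 => ? _).
have K0 : 0 < K by lra.
(* The first bound makes the quadratic expansion of [renyi] valid; the second keeps its error
   [2 (rho K)^2] below [rho d / 2], half of the rate slack. *)
pose rho := Num.min (2 * K)^-1 (d / (4 * K ^+ 2)).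
have rho0 : 0 < rho by rewrite lt_min invr_gt0 divr_gt0 ?mulr_gt0 ?exprn_gt0.
have rhoK : rho * K <= 2^-1.
  by rewrite -ler_pdivlMr // -invfM ge_min lexx.
have rho1 : rho <= 1 by nra.
have rhod : 2 * (rho * K) ^+ 2 <= rho * (d / 2).
  have : rho <= d / (4 * K ^+ 2) by rewrite ge_min lexx orbT.
  rewrite ler_pdivlMr ?mulr_gt0 ?exprn_gt0 // => h.
  rewrite exprMn; nra.
(* The other half of the slack survives as decay [exp (- rho N d / 2) = s^(2N)] of the divergence
   bound. *)
pose s := expR (- (rho * (d / 2) / 2)).
have s0 : 0 < s := expR_gt0 _.
have s1 : s < 1 by rewrite expR_lt1 oppr_lt0 !mulr_gt0 // divr_gt0.
pose Phi S := \sum_t pT t * renyi W qZ (fun l => qXT l t) S rho.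
have Phi_le S : Phi S <=
    expR (rho * (\sum_t pT t * info W qZ (fun l => qXT l t) S + d / 2)).
  apply: (@le_trans _ _ (1 + rho * (\sum_t pT t * info W qZ (fun l => qXT l t) S) +
    2 * (rho * K) ^+ 2)); last first.
    by apply: le_trans (expR_ge1Dx _); rewrite [in leRHS]mulrDr addrA lerD2l.
  have tot c : c = \sum_t pT t * c :> R by rewrite -mulr_suml hT.2 mul1r.
  rewrite {1}(tot 1) (tot (2 * _)) mulr_sumr -!big_split /=.
  apply: ler_sum => t _; rewrite mulrCA -!mulrDr ler_wpM2l ?hT.1 //.
  by apply: renyi_le => //; exact: ltW.
have Phi0 S : 0 <= Phi S.
  apply: sumr_ge0 => t _; rewrite mulr_ge0 ?hT.1 //.
  do 2 (apply: sumr_ge0 => ? _); rewrite mulr_ge0 ?powR_ge0 // mulr_ge0 ?hW.1 //.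
  exact: (pprod_pmf (hq^~ t)).1.
pose C : R := rho^-1 * \sum_(S : {set 'I_L} | S != finset.set0) 2 ^+ #|S|.
have C0 : 0 <= C.
  by rewrite mulr_ge0 ?invr_ge0 ?(ltW rho0) // sumr_ge0 // => S _; rewrite exprn_ge0.
have bound N : rho^-1 * \sum_(S | S != finset.set0)
    (\prod_(l in S) (msize r N l)%:R^-1) `^ rho * Phi S ^+ N <= C * (s ^+ N) ^+ 2.
  rewrite /C -mulrA ler_pM2l ?invr_gt0 // mulr_suml; apply: ler_sum => S Sn.
  have h1 : (\prod_(l in S) (msize r N l)%:R^-1) `^ rho <=
      2 ^+ #|S| * expR (- (rho * N%:R * (ln 2 * \sum_(l in S) r l))).
    rewrite powR_prod; last by move=> l; rewrite invr_ge0.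
    have -> : 2 ^+ #|S| * expR (- (rho * N%:R * (ln 2 * \sum_(l in S) r l))) =
        \prod_(l in S) (2 * expR (- (rho * N%:R * (ln 2 * r l)))) :> R.
      rewrite big_split /= prodr_const -expR_sum; congr (_ * expR _).
      by rewrite sumrN; congr (- _); rewrite !mulr_sumr.
    apply: ler_prod => l _; rewrite powR_ge0 /=.
    apply: (@le_trans _ _ ((2 * expR (- (N%:R * r l * ln 2))) `^ rho)).
      apply: ge0_ler_powR; rewrite ?nnegrE ?invr_ge0 ?mulr_ge0 ?expR_ge0 ?(ltW rho0) //.
      exact: msize_inv_le.
    rewrite powRM ?expR_ge0 //.
    rewrite -expRM; apply: ler_pM; rewrite ?powR_ge0 ?expR_ge0 //.
      have := @ler1_powR R 2 rho; apply; lra.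
    by rewrite ler_expR; lra.
  have h2 : Phi S ^+ N <=
      expR (N%:R * (rho * (\sum_t pT t * info W qZ (fun l => qXT l t) S + d / 2))).
    by rewrite expRM_natl lerXn2r ?nnegrE ?expR_ge0.
  apply: (le_trans (ler_pM (powR_ge0 _ _) (exprn_ge0 _ (Phi0 S)) h1 h2)).
  rewrite -[leLHS]mulrA.
  rewrite ler_pM2l ?exprn_gt0 // -expRD /s -exprM -expRM_natl ler_expR.
  have := hr S Sn; set I_S := \sum_t _; set R_S := _ * \sum_(l in S) _ => h.
  have : 0 <= rho * N%:R * (R_S - (I_S + d)) by apply: mulr_ge0; [apply: mulr_ge0; [exact: ltW|exact: ler0n]|rewrite subr_ge0].
  by rewrite natrM; lra.
have ex N : exists f : forall l, 'I_(msize r N l) -> {ffun 'I_N -> bool},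
    tvd (code_out W f) (fun y : {ffun 'I_N -> Z} => \prod_i qZ (y i)) <=
    (2 + C / 2) * s ^+ N.
  have sN : 0 < s ^+ N by rewrite exprn_gt0.
  (* Choosing [lam = s^N] balances [2 lam] against [C s^(2N) / (2 lam)]. *)
  have [f hf] := @exists_code R L Z W N hW T pT qXT qZ (msize r N) rho (s ^+ N)
    hT hq hout (fun l => msize_gt0 N (r0 l)) rho0 rho1 sN.
  exists f; apply: (le_trans hf); rewrite [leRHS]mulrDl lerD2l.
  apply: (@le_trans _ _ ((2 * s ^+ N)^-1 * (C * (s ^+ N) ^+ 2))).
    by rewrite ler_pM2l ?invr_gt0 ?mulr_gt0 //; exact: bound.
  rewrite le_eqVlt; apply/orP; left; apply/eqP; field.
  by rewrite expf_neq0 // gt_eqF.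
exists (fun N => sval (cid (ex N))).
apply: (@squeeze_cvgr _ _ _ _ (fun=> 0) (geometric (2 + C / 2) s)).
- near=> N; rewrite /= /geometric /=; apply/andP; split.
    by rewrite /tvd sumr_ge0.
  exact: (svalP (cid (ex N))).
- by apply: cvg_cst.
- by apply: cvg_geometric; rewrite gtr0_norm.
Unshelve. all: by end_near.
Qed.

Lemma region'_res_region (r : 'I_L -> R) : region' W qZ r -> res_region W qZ r.
Proof.
move=> [pT [qXT [hT [hq [hout hI]]]]] e e0.
have l2 := ln2_gt0.
have hI' S : \sum_t pT t * info W qZ (fun l => qXT l t) S <= ln 2 * \sum_(l in S) r l.
  by have := hI S; rewrite (MI_info pT S hW hq hout) ler_pdivrMl.
have r0 l : 0 <= r l.
  have := hI' [set l]%SET; rewrite big_set1 => h.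
  rewrite -(pmulr_rge0 _ l2); apply: le_trans h; apply: sumr_ge0 => t _.
  by rewrite mulr_ge0 ?hT.1 // info_ge0.
(* Raising every rate by [e / 2] makes all rates positive and leaves a strict gap for each nonempty
   [S], while staying within distance [e]. *)
exists (fun l => r l + e / 2); split; last first.
  by move=> l; rewrite opprD addNKr normrN gtr0_norm; lra.
apply: (@achievable_gt _ pT qXT _ (ln 2 * (e / 2))) => //.
- by rewrite mulr_gt0 //; lra.
- by move=> l; have := r0 l; lra.
move=> S Sn; rewrite big_split /= mulrDr lerD // ler_pM2l //.
have /set0Pn[l lS] := Sn.
rewrite (bigD1 l) //= lerDl; apply: sumr_ge0 => *; lra.
Qed.

End Achievability.

(** * Converse for a single block *)

Lemma ln_prod (R : realType) (I : finType) (P : pred I) (a : I -> R) :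
  (forall i, P i -> 0 < a i) -> ln (\prod_(i | P i) a i) = \sum_(i | P i) ln (a i).
Proof.
move=> a0; have [] // : 0 < \prod_(i | P i) a i /\
  ln (\prod_(i | P i) a i) = \sum_(i | P i) ln (a i).
apply: (big_rec2 (fun s t => 0 < s /\ ln s = t)); first by rewrite ln1.
by move=> i s t Pi [s0 <-]; rewrite mulr_gt0 ?a0 // lnM ?posrE ?a0.
Qed.

Section Converse.
Variables (R : realType) (L : nat) (Z : finType) (W : inp L -> Z -> R) (qZ : Z -> R).
Variables (N : nat) (P : 'I_L -> {ffun 'I_N -> bool} -> R) (M : 'I_L -> R).
Hypothesis hW : is_channel W.
Hypothesis qZ0 : forall z, 0 <= qZ z.
Hypothesis qZ1 : \sum_z qZ z = 1.
Hypothesis hP : forall l, is_pmf (P l).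
Hypothesis hM : forall l b, P l b != 0 -> (M l)^-1 <= P l b.
Hypothesis M0 : forall l, 0 < M l.

Let blk := {ffun 'I_N -> bool}.
Let V := @block_channel R L Z W N.
Let Pt y := \sum_x pprod P x * V x y.
Let Q (y : {ffun 'I_N -> Z}) := \prod_i qZ (y i).
Let delta := \sum_y `|Pt y - Q y|.
Let C := \sum_z `|ln (qZ z)|.

Definition letter (i : 'I_N) (l : 'I_L) (a : bool) : R :=
  \sum_b P l b * (b i == a)%:R.

Let W0 := hW.1.
Let W1 := hW.2.
Let V0 : forall x y, 0 <= V x y := block_channel_ge0 hW.
Let V1 : forall x, \sum_y V x y = 1 := block_channel_sum (N := N) hW.
Let px0 : forall x, 0 <= pprod P x := (pprod_pmf hP).1.
Let px1 : \sum_x pprod P x = 1 := (pprod_pmf hP).2.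

Lemma letter_pmf i l : is_pmf (letter i l).
Proof.
split=> [a|]; first by apply: sumr_ge0 => b _; rewrite mulr_ge0 // (hP l).1.
rewrite /letter exchange_big /= -[RHS](hP l).2; apply: eq_bigr => b _.
rewrite -mulr_sumr (bigD1 (b i)) //= eqxx [X in _ + X]big1 ?addr0 ?mulr1 // => a.
by rewrite eq_sym => /negbTE ->.
Qed.

Lemma letter_marginal i (g : inp L -> Z -> R) :
  \sum_x \sum_y pprod P x * V x y * g (slice x i) (y i) =
  \sum_a \sum_z pprod (letter i) a * W a z * g a z.
Proof.
transitivity (\sum_x pprod P x * (\sum_z W (slice x i) z * g (slice x i) z)).
  apply: eq_bigr => x _; under eq_bigr do rewrite -mulrA.
  rewrite -mulr_sumr; congr (_ * _).
  by rewrite (marginal_ffun (F := fun k => W (slice x k)) i) // => k; apply: W1.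
rewrite (pushforward_ffun P (fun b : blk => b i)
  (fun a => \sum_z W a z * g a z)).
by apply: eq_bigr => a _; rewrite mulr_sumr; apply: eq_bigr => z _; rewrite mulrA.
Qed.

(** The mass of [x_S] times the averaged channel is part of the sum defining [Pt y], and that mass
    is at least the product of the [(M l)^-1] over [S]. *)
Let cond_le S x y : 0 < pprod P x * V x y ->
  cond P S (V ^~ y) x <= (\prod_(l in S) M l) * Pt y.
Proof.
move=> h; have h1 : (\prod_(l in S) P l (x l)) * cond P S (V ^~ y) x <= Pt y.
  rewrite /cond mulr_sumr; apply: ler_sum => x' _; rewrite mulrA ler_wpM2r //.
  rewrite big_mkcond /= -big_split /=; apply: ler_prod => l _.
  have := (hP l).1; case: (l \in S) => /= p0; last by rewrite mul1r p0 lexx.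
  have [->|_] := eqVneq (x' l) (x l); rewrite ?mulr1 ?mulr0 ?p0 ?lexx //.
have Pl l : P l (x l) != 0.
  by apply: contraTneq h => hl; rewrite /pprod (bigD1 l) //= hl !mul0r ltxx.
have h2 : 1 <= (\prod_(l in S) M l) * \prod_(l in S) P l (x l).
  rewrite -big_split /=; apply: (@le_trans _ _ (\prod_(l in S) (1 : R))).
    by rewrite big1.
  apply: ler_prod => l _; rewrite ler01 /=.
  by rewrite -(mulfV (lt0r_neq0 (M0 l))) ler_pM2l // hM.
have c0 : 0 <= cond P S (V ^~ y) x by apply: cond_ge0.
have MS0 : 0 <= \prod_(l in S) M l by apply: prodr_ge0 => l _; apply: ltW.
apply: le_trans (ler_wpM2l MS0 h1); rewrite mulrA.
by rewrite ler_peMl.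
Qed.

Let Pt_pmf : is_pmf Pt.
Proof.
split=> [y|]; first by apply: sumr_ge0 => x _; rewrite mulr_ge0.
by rewrite /Pt exchange_big /=; under eq_bigr do rewrite -mulr_sumr V1 mulr1.
Qed.

Let Pt_gt0 x y : 0 < pprod P x * V x y -> 0 < Pt y.
Proof.
by move=> h; rewrite /Pt (bigD1 x) //= ltr_pwDl // sumr_ge0 // => *; rewrite mulr_ge0.
Qed.

Let sum_cond_le S :
  \sum_x \sum_y pprod P x * V x y * ln (cond P S (V ^~ y) x) <=
  \sum_(l in S) ln (M l) + \sum_y Pt y * ln (Pt y).
Proof.
have -> : \sum_(l in S) ln (M l) + \sum_y Pt y * ln (Pt y) =
  \sum_y \sum_x pprod P x * V x y * (\sum_(l in S) ln (M l) + ln (Pt y)).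
  under [RHS]eq_bigr do rewrite -mulr_suml mulrDr.
  by rewrite big_split /= -mulr_suml Pt_pmf.2 mul1r.
rewrite [leRHS]exchange_big /=; apply: ler_sum => x _; apply: ler_sum => y _.
have [->|h] := eqVneq (pprod P x * V x y) 0; first by rewrite !mul0r.
have hgt : 0 < pprod P x * V x y by rewrite lt_def h mulr_ge0.
have cg := cond_gt0 S hP (V0^~ y) hgt.
have pg := Pt_gt0 hgt.
have mg : 0 < \prod_(l in S) M l by apply: prodr_gt0 => l _.
rewrite ler_pM2l // -ln_prod // -lnM ?posrE // ler_ln ?posrE ?mulr_gt0 //.
exact: cond_le.
Qed.

Let lnQ (y : {ffun 'I_N -> Z}) := \sum_i ln (qZ (y i)).

Let lnQ_ge y : - (N%:R * C) <= lnQ y.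
Proof.
rewrite lerNl -sumrN.
have -> : N%:R * C = \sum_(i < N) C by rewrite sumr_const card_ord mulr_natl.
apply: ler_sum => i _; apply: (@le_trans _ _ `|ln (qZ (y i))|).
  by rewrite -normrN ler_norm.
by apply: (term_le_sum (F := fun z => `|ln (qZ z)|)).
Qed.

(* The entropy of [Pt] can only drop below the cross entropy with [Q] on the
   event [Pt > 2 Q], whose probability is at most [2 delta]. *)
Let entropy_le :
  \sum_y Pt y * ln (Pt y) <= ln 2 + \sum_y Pt y * lnQ y + 2 * delta * (N%:R * C).
Proof.
have C0 : 0 <= C by apply: sumr_ge0.
have NC0 : 0 <= N%:R * C by rewrite mulr_ge0.
have l2 := @ln2_gt0 R.
have -> : ln 2 + \sum_y Pt y * lnQ y + 2 * delta * (N%:R * C) =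
    \sum_y (Pt y * (ln 2 + lnQ y) + 2 * `|Pt y - Q y| * (N%:R * C)).
  rewrite big_split /= -mulr_suml -mulr_sumr.
  under [in RHS]eq_bigr do rewrite mulrDr.
  by rewrite big_split /= -mulr_suml Pt_pmf.2 mul1r.
apply: ler_sum => y _; have P0 := Pt_pmf.1 y.
have Q0 : 0 <= Q y by apply: prodr_ge0.
have d0 : 0 <= `|Pt y - Q y| := normr_ge0 _.
have [hle|hlt] := leP (Pt y) (2 * Q y).
  have [->|Pn] := eqVneq (Pt y) 0; first by rewrite !mul0r add0r !mulr_ge0.
  have Pg : 0 < Pt y by rewrite lt_def Pn.
  have Qg : 0 < Q y by lra.
  have qg i : 0 < qZ (y i).
    rewrite lt_def qZ0 andbT; apply: contraTneq Qg => hi.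
    by rewrite /Q (bigD1 i) //= hi mul0r ltxx.
  have h : Pt y * ln (Pt y) <= Pt y * (ln 2 + lnQ y).
    rewrite ler_pM2l //.
    rewrite /lnQ -(ln_prod (P := xpredT) (a := fun i => qZ (y i))) //.
    by rewrite -lnM ?posrE // ler_ln ?posrE ?mulr_gt0.
  apply: (le_trans h).
  by rewrite lerDl !mulr_ge0.
(* On the bad event the left side is nonpositive, and [Pt y <= 2 * |Pt y - Q y|] pays for the lower
   bound on [lnQ], which holds even where [Q y = 0]. *)
have h1 : ln (Pt y) <= 0 by apply: ln_le0; apply: pmf_le1 Pt_pmf.
have h2 : Pt y <= 2 * `|Pt y - Q y| by rewrite ger0_norm; lra.
have h3 := lnQ_ge y.
have h4 : Pt y * ln (Pt y) <= 0 by nra.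
have h5 : - (Pt y * (N%:R * C)) <= Pt y * lnQ y by rewrite -mulrN ler_wpM2l.
have h6 : Pt y * (N%:R * C) <= 2 * `|Pt y - Q y| * (N%:R * C) by rewrite ler_wpM2r.
have h7 : 0 <= Pt y * ln 2 by rewrite mulr_ge0 // ltW.
rewrite mulrDr; lra.
Qed.

Let lc S (x : {ffun 'I_L -> blk}) (y : {ffun 'I_N -> Z}) i :=
  cond (letter i) S (W ^~ (y i)) (slice x i).

Let letter_gt0 x y i : 0 < pprod P x * V x y ->
  0 < pprod (letter i) (slice x i) * W (slice x i) (y i).
Proof.
move=> h; have hW' : 0 < W (slice x i) (y i).
  rewrite lt_def W0 andbT; apply: contraTneq h => hw.
  by rewrite /V /block_channel (bigD1 i) //= hw !mul0r mulr0 ltxx.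
rewrite mulr_gt0 // prodr_gt0 // => l _.
have Pg : 0 < P l (x l).
  rewrite lt_def (hP l).1 andbT; apply: contraTneq h => hl.
  by rewrite /pprod (bigD1 l) //= hl !mul0r ltxx.
rewrite /letter (bigD1 (x l)) //= ffunE eqxx mulr1 ltr_pwDl // sumr_ge0 // => b _.
by rewrite mulr_ge0 // (hP l).1.
Qed.

(** Single-letterization: the product of the letterwise averaged channels is one particular channel
    seeing only [X_S], so Gibbs' inequality compares it with the true block conditional. *)
Let sum_cond_ge S :
  \sum_x \sum_y pprod P x * V x y * \sum_i ln (lc S x y i) <=
  \sum_x \sum_y pprod P x * V x y * ln (cond P S (V ^~ y) x).
Proof.
have lg x y i : 0 < pprod P x * V x y -> 0 < lc S x y i.
  move=> h; apply: cond_gt0 (letter_gt0 i h); [exact: letter_pmf|by move=> a; apply: W0].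
have lc0 x y i : 0 <= lc S x y i.
  by apply: cond_ge0 => [|a]; [exact: letter_pmf|exact: W0].
apply: le_trans (@gibbs_cond R L _ _ P S V (fun x y => \prod_i lc S x y i)
  hP V0 V1 _ _ _ _).
- rewrite le_eqVlt; apply/orP; left; apply/eqP.
  apply: eq_bigr => x _; apply: eq_bigr => y _.
  have [->|h] := eqVneq (pprod P x * V x y) 0; first by rewrite !mul0r.
  have hgt : 0 < pprod P x * V x y by rewrite lt_def h mulr_ge0.
  by rewrite ln_prod // => i _; apply: lg.
- by move=> x y; apply: prodr_ge0 => i _; apply: lc0.
- move=> x; rewrite /lc.
  rewrite (sum_ffun_prod (fun i z => cond (letter i) S (W ^~ z) (slice x i))).
  by rewrite big1 // => i _; apply: cond_sum => // l; apply: letter_pmf.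
- move=> x x' y h; apply: eq_bigr => i _; apply: cond_agree => l lS.
  by rewrite !ffunE h.
- by move=> x y h; apply: prodr_gt0 => i _; apply: lg.
Qed.

(** Chains the three bounds above; the cross entropy term [Pt y * lnQ y] cancels because [info] is
    normalized by [qZ]. *)
Lemma converse_block S :
  \sum_i info W qZ (letter i) S <=
  \sum_(l in S) ln (M l) + ln 2 + 2 * delta * (N%:R * C).
Proof.
have hI : \sum_i info W qZ (letter i) S =
    \sum_x \sum_y pprod P x * V x y * (\sum_i ln (lc S x y i)) - \sum_y Pt y * lnQ y.
  have -> : \sum_y Pt y * lnQ y = \sum_x \sum_y pprod P x * V x y * lnQ y.
    by rewrite exchange_big /=; apply: eq_bigr => y _; rewrite mulr_suml.
  rewrite -sumrB.
  transitivity (\sum_i \sum_x \sum_y pprod P x * V x y *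
      (ln (lc S x y i) - ln (qZ (y i)))).
    apply: eq_bigr => i _.
    by rewrite (letter_marginal i
      (fun a z => ln (cond (letter i) S (W ^~ z) a) - ln (qZ z))).
  rewrite exchange_big /=; apply: eq_bigr => x _.
  rewrite exchange_big /= -sumrB; apply: eq_bigr => y _.
  by rewrite -mulr_sumr sumrB mulrBr.
have := sum_cond_ge S; have := sum_cond_le S; have := entropy_le; rewrite hI; lra.
Qed.

(** Passing to a marginal does not increase the variational distance. *)
Lemma letter_out i z : `|out_dist W (letter i) z - qZ z| <= delta.
Proof.
have -> : out_dist W (letter i) z = \sum_y Pt y * (y i == z)%:R.
  rewrite out_distE; under [RHS]eq_bigr do rewrite /Pt mulr_suml.
  rewrite exchange_big /= (letter_marginal i (fun _ z' => (z' == z)%:R)).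
  apply: eq_bigr => a _; rewrite (bigD1 z) //= eqxx mulr1 big1 ?addr0 // => z' /negbTE ->.
  by rewrite mulr0.
have -> : qZ z = \sum_y Q y * (y i == z)%:R.
  rewrite /Q (marginal_ffun (F := fun=> qZ) i (fun z' => (z' == z)%:R)) //.
  rewrite (bigD1 z) //= eqxx mulr1 big1 ?addr0 // => z' /negbTE ->; by rewrite mulr0.
rewrite -sumrB; apply: (le_trans (ler_norm_sum _ _ _)); apply: ler_sum => y _.
by rewrite -mulrBl normrM; case: eqP; rewrite ?normr1 ?mulr1 // normr0 mulr0.
Qed.

End Converse.

(** * Caratheodory's theorem *)

Section Caratheodory.
Variable R : realFieldType.

Lemma linear_dependence (D : finType) (n : nat) (v : 'I_n -> D -> R) : (#|D| < n)%N ->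
  exists u : 'I_n -> R, (exists i, 0 < u i) /\ forall j, \sum_i u i * v i j = 0.
Proof.
move=> Dn; pose A := \matrix_(i < n, k < #|D|) v i (enum_val k).
have : kermx A != 0.
  rewrite kermx_eq0 /row_free; apply/eqP => hr.
  by have := rank_leq_col A; rewrite hr leqNgt Dn.
case/rowV0Pn => u /sub_kermxP uA un.
have hu j : \sum_i u 0 i * v i j = 0.
  have /matrixP/(_ 0 (enum_rank j)) := uA; rewrite !mxE => e; rewrite -[RHS]e.
  by apply: eq_bigr => i _; rewrite mxE enum_rankK.
have [i ui] : exists i, u 0 i != 0.
  apply/existsP; rewrite -negb_forall; apply: contra un => /forallP h.
  by apply/eqP/rowP => i; rewrite mxE; apply/eqP.
have [up|un'] := ltP 0 (u 0 i); first by exists (u 0); split; first by exists i.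
exists (fun i => - u 0 i); split.
  by exists i; rewrite oppr_gt0 lt_neqAle ui.
by move=> j; under eq_bigr do rewrite mulNr; rewrite sumrN hu oppr0.
Qed.

(** While there are more than [T] points, a linear dependence lets one weight be removed without
    changing the combination. *)
Lemma conic_caratheodory (D : finType) (T : nat) : (#|D| <= T)%N ->
  forall (n : nat) (i0 : 'I_n) (v : 'I_n -> D -> R) (w : 'I_n -> R),
  (forall i, 0 <= w i) ->
  exists (p : 'I_T -> R) (tau : 'I_T -> 'I_n),
    (forall t, 0 <= p t) /\
    forall j, \sum_t p t * v (tau t) j = \sum_i w i * v i j.
Proof.
move=> DT; elim=> [[]//|n IH] i0 v w w0.
have [nT|Tn] := leqP n.+1 T.
  (* With few points, pad by zero weights; the index returned by [inord] out of range is then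
     irrelevant. *)
  exists (fun t => if (t < n.+1)%N then w (inord t) else 0), inord.
  split=> [t|j]; first by case: ifP.
  transitivity (\sum_(i < n.+1) w (inord i) * v (inord i) j); last first.
    by apply: eq_bigr => i _; rewrite inord_val.
  rewrite (big_ord_widen T (fun i => w (inord i) * v (inord i) j)) // [RHS]big_mkcond /=.
  by apply: eq_bigr => t _; case: ifP => _; rewrite ?mul0r.
have [u [[k uk] hu]] := linear_dependence v (leq_ltn_trans DT Tn).
(* The smallest ratio over positive coefficients is the first moment at which a weight reaches 0,
   all others remaining nonnegative. *)
have [m um hm] := @arg_minP _ R 'I_n.+1 k [pred i | 0 < u i] (fun i => w i / u i) uk.
set th := w m / u m.
have um' : 0 < u m := um.
pose w' i := w i - th * u i.
have th0 : 0 <= th by rewrite divr_ge0 // ltW.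
have w'0 i : 0 <= w' i.
  rewrite /w' subr_ge0; have [ui|ui] := ltP 0 (u i).
    by rewrite -ler_pdivlMr //; apply: hm.
  by apply: le_trans (w0 i); rewrite mulr_ge0_le0.
have w'm : w' m = 0 by rewrite /w' /th divfK ?subrr // gt_eqF.
have w'v j : \sum_i w' i * v i j = \sum_i w i * v i j.
  under eq_bigr do rewrite mulrBl -mulrA.
  by rewrite sumrB -mulr_sumr hu mulr0 subr0.
have split' j : \sum_i w' i * v i j = \sum_i w' (lift m i) * v (lift m i) j.
  by rewrite (bigD1_ord m) //= w'm mul0r add0r.
(* Dropping the only point leaves no index for the induction hypothesis; every sum is then 0. *)
case: n => [|n] in IH i0 v w w0 Tn u k uk hu m um hm th um' w' th0 w'0 w'm w'v split' *.
  exists (fun=> 0), (fun=> i0); split => // j.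
  rewrite -w'v split' big_ord0 big1 // => t _; by rewrite mul0r.
have [p [tau [p0 hp]]] := IH ord0 (fun i => v (lift m i)) (fun i => w' (lift m i))
  (fun i => w'0 _).
exists p, (fun t => lift m (tau t)); split=> // j.
by rewrite hp -split' w'v.
Qed.

End Caratheodory.

(** * Continuity of [x ln x], finite sums and finite products *)

Section Continuity.
Variable R : realType.

(** With [x = s^2] and [ln (1/s) <= 1/s - 1]. For [x <= 0] the logarithm is 0 by convention, so the
    bound is two-sided. *)
Lemma xlnx_norm_le (x : R) : `|x| <= 1 -> `|x * ln x| <= 2 * Num.sqrt `|x|.
Proof.
move=> x1; have [x0|x0] := leP x 0; first by rewrite ln0 // mulr0 normr0 mulr_ge0.
rewrite gtr0_norm // in x1 *.
rewrite normrM gtr0_norm // ler0_norm ?ln_le0 //.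
set s := Num.sqrt x; have s0 : 0 < s by rewrite sqrtr_gt0.
have xs : x = s ^+ 2 by rewrite sqr_sqrtr // ltW.
have si : 0 < s^-1 by rewrite invr_gt0.
have h := ln_le_subr1 si; rewrite lnV ?posrE // in h.
have ss : s ^+ 2 * s^-1 = s by field; rewrite gt_eqF.
rewrite xs lnXn // -mulNrn mulrnAr -mulr_natl ler_pM2l //.
by rewrite -[leRHS]ss ler_pM2l ?exprn_gt0 //; lra.
Qed.

Lemma continuous_xlnx : continuous (fun x : R => x * ln x).
Proof.
move=> x; have [x0|x0|->] := ltgtP x 0.
- apply/cvgrPdist_le => e e0; near=> y.
  have y0 : y < 0 by near: y; apply: lt_nbhsl.
  by rewrite (ln0 (ltW x0)) (ln0 (ltW y0)) !mulr0 subrr normr0; exact: ltW.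
- apply: cvgM; first exact: cvg_id.
  exact: continuous_ln.
rewrite /continuous_at mul0r; apply/cvgr0Pnorm_le => e e0; near=> y.
have y1 : `|y| <= 1 by near: y; apply: (@cvgr0_norm_le R R R _ _ id); [exact: cvg_id|].
have ye : `|y| <= (e / 2) ^+ 2 by near: y; apply: (@cvgr0_norm_le R R R _ _ id); [exact: cvg_id|rewrite exprn_gt0 // divr_gt0].
apply: (le_trans (xlnx_norm_le y1)).
have e2 : 0 <= e / 2 by rewrite divr_ge0 // ltW.
rewrite -ler_pdivlMl // mulrC -[leRHS](ger0_norm e2).
by rewrite -[leRHS]sqrtr_sqr ler_sqrt // exprn_ge0.
Unshelve. all: by end_near.
Qed.

Lemma continuous_bigsum (U : topologicalType) (I : finType) (P : pred I)
    (F : I -> U -> R) :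
  (forall i, P i -> continuous (F i)) -> continuous (fun u => \sum_(i | P i) F i u).
Proof. by apply: continuous_big; exact: add_continuous. Qed.

Lemma continuous_bigprod (U : topologicalType) (I : finType) (P : pred I)
    (F : I -> U -> R) :
  (forall i, P i -> continuous (F i)) -> continuous (fun u => \prod_(i | P i) F i u).
Proof. by apply: continuous_big; exact: mul_continuous. Qed.

End Continuity.

(** * Compactness *)

Section ContinuousOperations.
Variables (R : realType) (U : topologicalType).
Implicit Types f g : U -> R.

Lemma continuous_add f g : continuous f -> continuous g ->
  continuous (fun u => f u + g u).
Proof. by move=> cf cg u; apply: cvgD; [exact: cf|exact: cg]. Qed.

Lemma continuous_sub f g : continuous f -> continuous g ->
  continuous (fun u => f u - g u).
Proof. by move=> cf cg u; apply: cvgB; [exact: cf|exact: cg]. Qed.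

Lemma continuous_mul f g : continuous f -> continuous g ->
  continuous (fun u => f u * g u).
Proof. by move=> cf cg u; apply: cvgM; [exact: cf|exact: cg]. Qed.

Lemma continuous_norm f : continuous f -> continuous (fun u => `|f u|).
Proof. by move=> cf u; apply: cvg_norm; exact: cf. Qed.

Lemma continuous_const (c : R) : continuous (fun _ : U => c).
Proof. by move=> u; apply: cvg_cst. Qed.

End ContinuousOperations.

Section Closedness.
Variables (R : realType) (L : nat) (Z : finType) (W : inp L -> Z -> R) (qZ : Z -> R).
Variable T : nat.

(* The map [x ln x] is continuous at [0], so this form of [info] is continuous
   in [q]; it agrees with [info] on distributions by the tower rule. *)
Definition info_xlnx (q : 'I_L -> bool -> R) (S : {set 'I_L}) : R :=
  \sum_x pprod q x * (\sum_z cond q S (W ^~ z) x * ln (cond q S (W ^~ z) x)) -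
  \sum_x \sum_z pprod q x * W x z * ln (qZ z).

Lemma info_xlnxE q S : (forall l, is_pmf (q l)) -> info_xlnx q S = info W qZ q S.
Proof.
move=> hq; rewrite /info.
under [RHS]eq_bigr do under eq_bigr do rewrite mulrBr.
under [RHS]eq_bigr do rewrite sumrB.
rewrite sumrB; congr (_ - _).
under eq_bigr do rewrite mulr_sumr.
rewrite exchange_big [RHS]exchange_big /=; apply: eq_bigr => z _.
under eq_bigr do rewrite mulrA.
by rewrite cond_tower // => x x' h; rewrite (cond_agree _ _ h).
Qed.

(** All weights and input probabilities form one point of a product of real lines, so that
    Tychonoff's theorem makes the unit cube compact. *)
Let Ix := ('I_T + 'I_L * 'I_T * bool)%type.
Let U : topologicalType := prod_topology (fun _ : Ix => R).
Let pu (u : U) (t : 'I_T) : R := u (inl t).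
Let qu (u : U) (l : 'I_L) (t : 'I_T) (b : bool) : R := u (inr (l, t, b)).

Let continuous_coord (i : Ix) : continuous (fun u : U => u i : R).
Proof. exact: (@proj_continuous Ix (fun _ => R) i). Qed.

Let continuous_pprod t x : continuous (fun u : U => pprod (fun l => qu u l t) x).
Proof. by apply: continuous_bigprod => l _; apply: continuous_coord. Qed.

Let continuous_cond t S (V : inp L -> R) x :
  continuous (fun u : U => cond (fun l => qu u l t) S V x).
Proof.
apply: continuous_bigsum => x' _; apply: continuous_mul; last exact: continuous_const.
apply: continuous_bigprod => l _.
by case: (l \in S); [exact: continuous_const|exact: continuous_coord].
Qed.

Let continuous_out t z : continuous (fun u : U => out_dist W (fun l => qu u l t) z).
Proof.
apply: continuous_bigsum => x _; apply: continuous_mul; first exact: continuous_const.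
exact: continuous_pprod.
Qed.

Let continuous_info t S : continuous (fun u : U => info_xlnx (fun l => qu u l t) S).
Proof.
apply: continuous_sub; apply: continuous_bigsum => x _.
  apply: continuous_mul; first exact: continuous_pprod.
  apply: continuous_bigsum => z _ u.
  apply: (@continuous_comp _ _ _ (fun u : U => cond (fun l => qu u l t) S (W ^~ z) x)
    (fun y : R => y * ln y)); first exact: continuous_cond.
  exact: continuous_xlnx.
apply: continuous_bigsum => z _; apply: continuous_mul; last exact: continuous_const.
by apply: continuous_mul; [exact: continuous_pprod|exact: continuous_const].
Qed.

(** The violations of all constraints add up to a continuous nonnegative penalty [G]. It attains its
    minimum on the cube, and approximate solutions force that minimum to be 0. *)
Lemma approx_closed (c : {set 'I_L} -> R) :
  (forall e : R, 0 < e -> exists (pT : 'I_T -> R) (qXT : 'I_L -> 'I_T -> bool -> R),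
    [/\ is_pmf pT, forall l t, is_pmf (qXT l t),
        forall t z, `|out_dist W (fun l => qXT l t) z - qZ z| <= e &
        forall S, S != finset.set0 ->
          \sum_t pT t * info W qZ (fun l => qXT l t) S <= c S + e]) ->
  exists (pT : 'I_T -> R) (qXT : 'I_L -> 'I_T -> bool -> R),
    [/\ is_pmf pT, forall l t, is_pmf (qXT l t),
        forall t z, qZ z = out_dist W (fun l => qXT l t) z &
        forall S, S != finset.set0 ->
          \sum_t pT t * info W qZ (fun l => qXT l t) S <= c S].
Proof.
move=> happ.
pose D (u : U) S := \sum_t pu u t * info_xlnx (fun l => qu u l t) S - c S.
pose G1 (u : U) := `|\sum_t pu u t - 1|.
pose G2 (u : U) := \sum_(lt : 'I_L * 'I_T) `|\sum_b qu u lt.1 lt.2 b - 1|.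
pose G3 (u : U) := \sum_(tz : 'I_T * Z)
  `|out_dist W (fun l => qu u l tz.1) tz.2 - qZ tz.2|.
(* Each term is twice the positive part of [D u S], hence vanishes exactly when the inequality for
   [S] holds. *)
pose G4 (u : U) := \sum_(S | S != finset.set0) (`|D u S| + D u S).
pose G (u : U) := G1 u + G2 u + G3 u + G4 u.
have cD S : continuous (fun u : U => D u S).
  apply: continuous_sub; last exact: continuous_const.
  apply: continuous_bigsum => t _; apply: continuous_mul; first exact: continuous_coord.
  exact: continuous_info.
have cG : continuous (G : U -> R).
  apply: continuous_add; last first.
    apply: continuous_bigsum => S _; apply: continuous_add; last exact: cD.
    exact/continuous_norm/cD.
  apply: continuous_add; last first.
    apply: continuous_bigsum => tz _; apply: continuous_norm; apply: continuous_sub.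
      exact: continuous_out.
    exact: continuous_const.
  apply: continuous_add; last first.
    apply: continuous_bigsum => lt _; apply: continuous_norm; apply: continuous_sub.
      by apply: continuous_bigsum => b _; exact: continuous_coord.
    exact: continuous_const.
  apply: continuous_norm; apply: continuous_sub; last exact: continuous_const.
  by apply: continuous_bigsum => t _; exact: continuous_coord.
pose A : set U := [set u : U | forall i, `[0, 1]%classic (u i : R)]%classic.
have cA : compact A.
  exact: (@tychonoff Ix (fun _ => R) (fun _ => `[0, 1]%classic)
    (fun _ => @segment_compact R 0 1)).
have mk (pT : 'I_T -> R) (qXT : 'I_L -> 'I_T -> bool -> R) :
    is_pmf pT -> (forall l t, is_pmf (qXT l t)) ->
    exists u : U, [/\ A u, pu u = pT & qu u = qXT].
  move=> hp hq.
  exists (fun i : Ix => match i with inl t => pT t | inr (l, t, b) => qXT l t b end).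
  split=> //; move=> [t|[[l t] b]] /=; rewrite in_itv /=.
    by rewrite hp.1 (pmf_le1 _ hp).
  by rewrite (hq l t).1 (pmf_le1 _ (hq l t)).
have G1_0 u : 0 <= G1 u by apply: normr_ge0.
have G2_0 u : 0 <= G2 u by apply: sumr_ge0.
have G3_0 u : 0 <= G3 u by apply: sumr_ge0.
have D0 u S : 0 <= `|D u S| + D u S by have := ler_norm (- D u S); rewrite normrN; lra.
have G4_0 u : 0 <= G4 u by apply: sumr_ge0.
have Asmall e : 0 < e -> exists2 u, A u & G u <= e.
  (* [n] counts the penalty terms with their factors; the leading 1 only keeps it positive. *)
  move=> e0; pose n : R := 1 + #|{: 'I_T * Z}|%:R + 2 * #|{: {set 'I_L}}|%:R.
  have n0 : 0 < n by rewrite /n -addrA ltr_pwDl // addr_ge0 // mulr_ge0.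
  have en0 : 0 < e / n by rewrite divr_gt0.
  have [pT [qXT [hp hq ho hi]]] := happ _ en0.
  have [u [Au pE qE]] := mk _ _ hp hq; exists u => //.
  have g1 : G1 u = 0 by rewrite /G1 pE hp.2 subrr normr0.
  have g2 : G2 u = 0.
    by rewrite /G2 qE big1 // => lt _; rewrite (hq lt.1 lt.2).2 subrr normr0.
  have g3 : G3 u <= #|{: 'I_T * Z}|%:R * (e / n).
    rewrite mulr_natl -sumr_const; apply: ler_sum => tz _; rewrite qE; exact: ho.
  have g4 : G4 u <= #|{: {set 'I_L}}|%:R * (2 * (e / n)).
    rewrite mulr_natl -sumr_const /G4 big_mkcond /=; apply: ler_sum => S _.
    case: ifP => Sn; last by rewrite mulr_ge0 // ltW.
    have : D u S <= e / n.
      rewrite /D pE qE lerBlDl.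
      under eq_bigr do rewrite info_xlnxE //.
      exact: hi.
    move: (D u S) (e / n) en0 => d a a0 da.
    by have [d0|d0] := leP 0 d; [rewrite ger0_norm|rewrite ltr0_norm]; lra.
  have -> : e = n * (e / n) by rewrite mulrC divfK // gt_eqF.
  have -> : n * (e / n) = e / n +
      (#|{: 'I_T * Z}|%:R * (e / n) + #|{: {set 'I_L}}|%:R * (2 * (e / n))).
    by rewrite /n; ring.
  by rewrite /G g1 g2 !add0r ler_wpDl ?(ltW en0) // lerD.
have A0 : (A !=set0)%classic.
  by have [u Au _] := Asmall 1 ltr01; exists u.
have [u /set_mem Au hmin] := compact_EVT_min A0 cA (continuous_subspaceT cG).
have Gu : G u <= 0.
  rewrite leNgt; apply/negP => Gpos.
  have [v Av Gv] := Asmall (G u / 2) (divr_gt0 Gpos (ltr0Sn _ 1)).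
  have := le_trans (hmin v (mem_set Av)) Gv.
  by rewrite leNgt => /negP; apply; rewrite ltr_pdivrMr // ltr_pMr // ltr1n.
have [g1 g2 g3 g4] : [/\ G1 u = 0, G2 u = 0, G3 u = 0 & G4 u = 0].
  have := G1_0 u; have := G2_0 u; have := G3_0 u; have := G4_0 u; move: Gu; rewrite /G.
  move: (G1 u) (G2 u) (G3 u) (G4 u) => a b d e' *; split; lra.
have u0 i : 0 <= (u i : R) by have := Au i; rewrite /= in_itv /= => /andP[].
have hq l t : is_pmf (qu u l t).
  split=> [b|]; first exact: u0.
  move/eqP: g2; rewrite psumr_eq0 // => /allP/(_ (l, t) (mem_index_enum _)) /=.
  by rewrite normr_eq0 subr_eq0 => /eqP.
exists (pu u), (qu u); split=> //.
- split=> [t|]; first exact: u0.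
  by apply/eqP; rewrite -subr_eq0 -normr_eq0; apply/eqP.
- move=> t z; move/eqP: g3; rewrite psumr_eq0 //.
  move=> /allP/(_ (t, z) (mem_index_enum _)) /=.
  by rewrite normr_eq0 subr_eq0 => /eqP.
move=> S Sn; move/eqP: g4; rewrite psumr_eq0 // => /allP/(_ S (mem_index_enum _)) /=.
rewrite Sn /= => /eqP h.
have : D u S <= 0.
  by have := normr_ge0 (D u S); move: h; move: (D u S) `|D u S| => d a; lra.
rewrite /D subr_le0; apply: le_trans; rewrite le_eqVlt; apply/orP; left; apply/eqP.
by apply: eq_bigr => t _; rewrite info_xlnxE.
Qed.

End Closedness.

(** * The region *)

Section ConverseLimit.
Variables (R : realType) (L : nat) (Z : finType) (W : inp L -> Z -> R) (qZ : Z -> R).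
Hypothesis hW : is_channel W.
Hypothesis qZ0 : forall z, 0 <= qZ z.
Hypothesis qZ1 : \sum_z qZ z = 1.

(** An empty message set makes the normalizing factor [0^-1 = 0], so the output is identically 0 and
    lies at distance 1 from the target. *)
Lemma code_out_msize_gt0 N (M : 'I_L -> nat)
    (f : forall l, 'I_(M l) -> {ffun 'I_N -> bool}) :
  tvd (code_out W f) (fun y : {ffun 'I_N -> Z} => \prod_i qZ (y i)) < 1 ->
  forall l, (0 < M l)%N.
Proof.
move=> h l; rewrite lt0n; apply: contraTneq h => Ml0; rewrite -leNgt.
have out0 y : code_out W f y = 0.
  by rewrite /code_out (bigD1 l) //= Ml0 mul0r invr0 mul0r.
rewrite /tvd; under eq_bigr do rewrite out0 sub0r normrN ger0_norm ?prodr_ge0 //.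
by rewrite (sum_ffun_prod (fun=> qZ)) big1.
Qed.

Lemma ln_msize_le (r : 'I_L -> R) N l : (0 < msize r N l)%N ->
  ln (msize r N l)%:R <= N%:R * r l * ln 2.
Proof.
move=> m0; have p0 : (0 : R) < 2 `^ (N%:R * r l) by apply: powR_gt0.
by rewrite -ln_powR ler_ln ?posrE ?ltr0n // truncn_le ltW.
Qed.

Lemma code_single_letter (r : 'I_L -> R) N
    (f : forall l, 'I_(msize r N l) -> {ffun 'I_N -> bool}) :
  let d := tvd (code_out W f) (fun y : {ffun 'I_N -> Z} => \prod_i qZ (y i)) in
  d < 1 ->
  exists q : 'I_N -> 'I_L -> bool -> R,
  [/\ forall i l, is_pmf (q i l),
      forall i z, `|out_dist W (q i) z - qZ z| <= d &
      forall S, \sum_i info W qZ (q i) S <=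
        N%:R * (ln 2 * \sum_(l in S) r l) + ln 2 +
        2 * d * (N%:R * \sum_z `|ln (qZ z)|)].
Proof.
move=> d d1; have M0 := code_out_msize_gt0 d1.
have MR l : (0 : R) < (msize r N l)%:R by rewrite ltr0n.
(* Codewords may repeat, so the atoms of [P l] have mass at least, and not exactly, the inverse
   message count. *)
pose P l := empirical R [ffun m => f l m].
have hP l : is_pmf (P l) by split; [exact: empirical_ge0|exact: empirical_sum].
have hM l b : P l b != 0 -> (msize r N l)%:R^-1 <= P l b.
  move=> hb; have [m hm] : exists m, f l m == b.
    apply/existsP; apply: contraNT hb; rewrite negb_exists => /forallP h.
    by apply/eqP/big1 => m _; rewrite ffunE (negbTE (h m)) mulr0.
  rewrite /P /empirical (bigD1 m) //= ffunE hm mulr1 lerDl.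
  by apply: sumr_ge0 => m' _; rewrite mulr_ge0 ?invr_ge0.
have dE : \sum_y `|\sum_x pprod P x * block_channel W x y - \prod_i qZ (y i)| = d.
  apply: eq_bigr => y _; rewrite code_outE; congr (`|_ - _|).
  apply: eq_bigr => x _; congr (_ * _); apply: eq_bigr => l _.
  by apply: eq_bigr => m _; rewrite ffunE.
exists (letter P); split; first by move=> i l; exact: letter_pmf.
  by move=> i z; have := letter_out P hW qZ1 i z; rewrite dE.
move=> S; have := converse_block hW qZ0 hP hM MR S.
rewrite dE => /le_trans; apply; rewrite !lerD2r !mulr_sumr; apply: ler_sum => l _.
by apply: (le_trans (ln_msize_le (M0 l))); lra.
Qed.

(** The time index of a good code, uniform over its [N] letters, serves as time-sharing variable;
    Caratheodory's theorem in dimension [2 ^ L] then replaces [N] by [T]. *)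
Lemma res_region_approx (r : 'I_L -> R) (T : nat) : (2 ^ L <= T)%N ->
  res_region W qZ r ->
  forall e : R, 0 < e -> exists (pT : 'I_T -> R) (qXT : 'I_L -> 'I_T -> bool -> R),
    [/\ is_pmf pT, forall l t, is_pmf (qXT l t),
        forall t z, `|out_dist W (fun l => qXT l t) z - qZ z| <= e &
        forall S, S != finset.set0 ->
          \sum_t pT t * info W qZ (fun l => qXT l t) S <=
          ln 2 * \sum_(l in S) r l + e].
Proof.
move=> LT hr e e0.
have l2 := @ln2_gt0 R.
pose C := \sum_z `|ln (qZ z)|; have C0 : 0 <= C by apply: sumr_ge0.
(* The final error splits into three parts of [e / 4]: moving the rates by [eta], the term
   [ln 2 / N], and the distance of the code. *)
pose eta := e / (4 * ln 2 * (L%:R + 1)).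
have L1 : (0 : R) < L%:R + 1 by rewrite ltr_wpDl.
have eta0 : 0 < eta by rewrite divr_gt0 // !mulr_gt0.
have [r' [[f hf] hr']] := hr eta eta0.
(* In turn: message sets are nonempty, letter outputs are within [e] of [qZ], and
   [2 d C <= e / 4]. *)
pose d0 := Num.min (2^-1) (Num.min e (e / (8 * (C + 1)))).
have d00 : 0 < d0.
  by rewrite !lt_min e0 invr_gt0 ltr0n divr_gt0 // mulr_gt0 //; lra.
pose d N := tvd (code_out W (f N)) (fun y : {ffun 'I_N -> Z} => \prod_i qZ (y i)).
have [N [N0 dN lN]] : exists N, [/\ (0 < N)%N, d N <= d0 & ln 2 / N%:R <= e / 4].
  have : (\forall N \near \oo, [/\ (0 < N)%N, d N <= d0 & ln 2 / N%:R <= e / 4])%classic.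
    near=> N; have N0 : (0 < N)%N by near: N; exact: nbhs_infty_gt.
    split=> //.
      apply: (le_trans (ler_norm _)); near: N.
      exact: (@cvgr0_norm_le R R nat _ _ d hf).
    rewrite ler_pdivrMr ?ltr0n // mulrC -ler_pdivrMr ?divr_gt0 //.
    by near: N; exact: nbhs_infty_ger.
  by case=> N _ /(_ N (leqnn N)) h; exists N.
have dN1 : d N < 1.
  apply: (le_lt_trans dN); apply: (@le_lt_trans _ _ 2^-1); last by lra.
  by rewrite ge_min lexx.
have dNe : d N <= e.
  by apply: (le_trans dN); rewrite !ge_min lexx orbT.
have d_ge0 : 0 <= d N by rewrite /d /tvd sumr_ge0.
have dNC : 2 * d N * C <= e / 4.
  have h : d N <= e / (8 * (C + 1)) by apply: (le_trans dN); rewrite !ge_min lexx !orbT.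
  rewrite ler_pdivlMr in h; last by lra.
  nra.
have [q [hq hout hI]] := @code_single_letter r' N (f N) dN1.
(* The coordinate [set0] carries the normalization of the weights. *)
pose v i (S : {set 'I_L}) := if S == finset.set0 then 1 else info W qZ (q i) S.
have cardD : (#|{: {set 'I_L}}| <= T)%N.
  by rewrite -cardsT -powersetT card_powerset cardsT card_ord.
have [p [tau [p0 hp]]] := @conic_caratheodory R _ T cardD N (Ordinal N0) v
  (fun=> N%:R^-1) (fun=> ltac:(by rewrite invr_ge0)).
have NR : (0 : R) < N%:R by rewrite ltr0n.
exists p, (fun l t => q (tau t) l); split.
- split=> //; have := hp finset.set0; rewrite /v eqxx.
  under eq_bigr do rewrite mulr1; move=> ->.
  by rewrite sumr_const card_ord mulr1 -[LHS]mulr_natl divff // gt_eqF.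
- by move=> l t; exact: hq.
- by move=> t z; apply: le_trans (hout _ _) dNe.
move=> S Sn; have := hp S; rewrite /v (negbTE Sn) -mulr_sumr => ->.
rewrite ler_pdivrMl //; apply: (le_trans (hI S)).
have hr'S : ln 2 * \sum_(l in S) r' l <= ln 2 * \sum_(l in S) r l + e / 4.
  have h : \sum_(l in S) r' l <= \sum_(l in S) r l + L%:R * eta.
    apply: (@le_trans _ _ (\sum_(l in S) (r l + eta))).
      by apply: ler_sum => l _; have := hr' l; rewrite ltr_norml => /andP[]; lra.
    rewrite big_split /= lerD2l sumr_const -[eta *+ _]mulr_natl ler_pM2r // ler_nat.
    by rewrite -[leqRHS](card_ord L) max_card.
  have h2 : ln 2 * (L%:R * eta) <= e / 4.
    have -> : e / 4 = ln 2 * ((L%:R + 1) * eta) by rewrite /eta; field; rewrite !gt_eqF.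
    by rewrite ler_pM2l // ler_pM2r //; lra.
  by apply: le_trans (_ : _ <= ln 2 * (\sum_(l in S) r l + L%:R * eta)) _;
    rewrite ?ler_pM2l // mulrDr lerD2l.
have lN' : ln 2 <= N%:R * (e / 4) by rewrite mulrC -ler_pdivrMr.
have dNC' : 2 * d N * (N%:R * C) <= N%:R * (e / 4).
  by rewrite mulrCA ler_pM2l.
have hr'N := ler_wpM2l (ltW NR) hr'S.
rewrite -/C -/(d N).
have Ne : 0 <= N%:R * e by rewrite mulr_ge0 // ltW.
move: hr'N lN' dNC'; rewrite mulrDr [in X in _ -> X]mulrDr.
move: (N%:R * (ln 2 * \sum_(l in S) r' l)) (N%:R * (ln 2 * \sum_(l in S) r l))
  (2 * d N * (N%:R * C)) (ln 2) => a b c l *.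
lra.
Unshelve. all: by end_near.
Qed.

End ConverseLimit.

Theorem theorem4 (R : realType) (L : nat) (Z : finType)
  (W : inp L -> Z -> R) (qZ : Z -> R) :
  (1 <= L)%N ->
  is_channel W ->
  (exists qX : 'I_L -> bool -> R,
      (forall l, is_pmf (qX l)) /\ (forall z, qZ z = out_dist W qX z)) ->
  forall r : 'I_L -> R, res_region W qZ r <-> region' W qZ r.
Proof.
move=> _ hW [qX [hX hZ]] r; split; last exact: region'_res_region.
have [W0 W1] := hW; have [px0 px1] := pprod_pmf hX.
have qZ0 z : 0 <= qZ z.
  by rewrite hZ out_distE sumr_ge0 // => x _; rewrite mulr_ge0.
have qZ1 : \sum_z qZ z = 1.
  under eq_bigr do rewrite hZ out_distE.
  by rewrite exchange_big /=; under eq_bigr do rewrite -mulr_sumr W1 mulr1.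
(* A channel cannot have an empty output alphabet; hence [|Z| - 1 >= 0] and [Tcard] is at least the
   [2 ^ L] that Caratheodory's theorem requires. *)
have Z0 : (0 < #|Z|)%N.
  rewrite lt0n; apply/negP => /eqP/card0_eq Z0.
  have /eqP := W1 [ffun=> false]; rewrite big1 => [|z]; first by rewrite eq_sym oner_eq0.
  by have := Z0 z; rewrite inE.
have LT : (2 ^ L <= Tcard L Z)%N by rewrite /Tcard -addnBAC // leq_addl.
move=> hr; have [pT [qXT [hT hq hout hI]]] :=
  approx_closed (c := fun S => ln 2 * \sum_(l in S) r l)
    (res_region_approx hW qZ0 qZ1 LT hr).
exists pT, qXT; do 3 split=> //.
move=> S; rewrite (MI_info pT S hW hq hout) ler_pdivrMl ?ln2_gt0 //.
(* For the empty set the averaged channel is [qZ] itself, so the density vanishes. *)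
have [->|Sn] := eqVneq S finset.set0; last exact: hI.
rewrite big_set0 mulr0 big1 // => t _.
rewrite /info big1 ?mulr0 // => x _; apply: big1 => z _.
by rewrite cond_set0 (hout t) out_distE subrr mulr0.
Qed.
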